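(* Let $0\le u_0\in L^1(\mathbb{R})\cap L^\infty(\mathbb{R})$. For $p>1$, $m>1$ let $u_{m,p}$ be the unique solution of $u_t+(u^m)_x=-u^p$ in $\mathbb{R}\times(0,\infty)$, $u(x,0)=u_0(x)$ in $\mathbb{R}$. Let $u_{\infty,p}=\lim_{m\to\infty}u_{m,p}$, let $u_\infty^0$ be the initial value of $u_{\infty,p}$, and let $u_{m,\infty}=\lim_{p\to\infty}u_{m,p}$ (see context). Then: (i) as $m\to\infty$, $u_{m,\infty}$ converges in $L^1_{loc}(\mathbb{R}\times(0,\infty))$ to some function $v_1=v_1(x)$ on $\mathbb{R}$, $0\le v_1\le 1$, which satisfies $$v_1(x)+\psi_1(x)_x=\min\{u_0(x),1\}\quad\text{in }\mathcal{D}'(\mathbb{R})$$ for some function $0\le\psi_1\in L^1(\mathbb{R})\cap L^\infty(\mathbb{R})$ such that $\psi_1(x)=0$ for a.e. $x\in\{x:v_1(x)<1\}$; (ii) as $p\to\infty$, $u_{\infty,p}$ converges weakly in $L^1_{loc}(\mathbb{R}\times(0,\infty))$ to $u_\infty^0$ (regarded as a function of $(x,t)$ independent of $t$).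
   Context: Notion of solution (Kruzkov). For $m>1$, $\varphi\in C^1([0,\infty))$ and $0\le u_0\in L^\infty(\mathbb{R})$, a function $0\le u\in L^\infty(\mathbb{R}\times(0,\infty))$ is a solution of $u_t+(u^m)_x=\varphi(u)$ in $\mathbb{R}\times(0,\infty)$, $u(x,0)=u_0(x)$ in $\mathbb{R}$, if: (i) for every $k\ge 0$ and every $0\le\eta\in C_0^\infty(\mathbb{R}\times(0,\infty))$, $$\int_0^\infty\int_{\mathbb{R}}\{|u-k|\eta_t+|u^m-k^m|\eta_x+\mathrm{sign}(u-k)\varphi(u)\eta\}\,dx\,dt\ge 0;$$ (ii) there is a null set $\mathcal{E}\subset[0,\infty)$ such that for $t\in[0,\infty)\setminus\mathcal{E}$ the function $u(\cdot,t)$ is defined a.e. in $\mathbb{R}$ and $\int_{|x|\le r}|u(x,t)-u_0(x)|\,dx\to 0$ as $t\to0$, $t\notin\mathcal{E}$, for every $r>0$. Existence and uniqueness of solutions is known (Kruzkov) for $\varphi(u)=-u^p$ and $\varphi=0$, for all $m,p>1$ and $0\le u_0\in L^\infty(\mathbb{R})$; solutions are taken in their representative continuous in $t>0$ with values in $L^1_{loc}(\mathbb{R})$. The limit functions. For $0\le u_0\in L^1(\mathbb{R})\cap L^\infty(\mathbb{R})$: (a) For each $p>1$, $u_{\infty,p}$ is the limit of $u_{m,p}$ as $m\to\infty$ in $C([t_0,T];L^1_{loc}(\mathbb{R}))$ for any $T>t_0>0$. It satisfies $0\le u_{\infty,p}\le1$ and $u_t=-u^p$ in $\mathcal{D}'(\mathbb{R}\times(0,\infty))$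 with initial value $u_\infty^0(x)=\lim_{t\to0^+}u_{\infty,p}(x,t)$ for a.e. $x$. The function $u^0_\infty$, $0\le u_\infty^0\le1$, satisfies $u_\infty^0+\psi_x=u_0$ in $\mathcal{D}'(\mathbb{R})$ for some $0\le\psi\in L^1(\mathbb{R})\cap L^\infty(\mathbb{R})$ with $\psi=0$ a.e. on $\{u_\infty^0<1\}$; it is uniquely determined by these conditions, hence independent of $p$. (b) For each $m>1$, $u_{m,\infty}$ is the limit of $u_{m,p}$ as $p\to\infty$ in $C([t_0,T];L^1_{loc}(\mathbb{R}))$ for any $T>t_0>0$; it is the solution of $u_t+(u^m)_x=0$ in $\mathbb{R}\times(0,\infty)$, $u(x,0)=\min(u_0(x),1)$. Weak convergence in $L^1_{loc}(\mathbb{R}\times(0,\infty))$ means convergence of integrals against every bounded measurable function with compact support in $\mathbb{R}\times(0,\infty)$. *)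

(* Defs.v *)
From HB Require Import structures.
From mathcomp Require Import all_boot all_order all_algebra.
From mathcomp Require Import all_classical all_reals all_analysis.

Set Implicit Arguments.
Unset Strict Implicit.
Unset Printing Implicit Defensive.

Import Order.TTheory GRing.Theory Num.Theory.
Import numFieldNormedType.Exports.

Local Open Scope classical_set_scope.
Local Open Scope ring_scope.

(* A point of the plane is a pair z = (x, t), space first, time second.
   Measurability is Borel measurability, every L^oo or L^1_loc class having
   a Borel representative. *)

Definition leb (R : realType) : {measure set (measurableTypeR R) -> \bar R} :=
  @lebesgue_measure R.
Arguments leb : clear implicits.

Definition leb2 (R : realType) :
    {measure set (measurableTypeR R * measurableTypeR R) -> \bar R} :=
  (@lebesgue_measure R \x @lebesgue_measure R)%E.
Arguments leb2 : clear implicits.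

Definition halfplane (R : realType) : set (R * R) := [set z | 0 < z.2].
Arguments halfplane : clear implicits.

Definition slice (R : realType) (u : R * R -> R) (t : R) : R -> R :=
  fun x => u (x, t).

Definition dist_L1 (R : realType) (r : R) (f g : R -> R) : \bar R :=
  (\int[leb R]_(x in [set y : R | `|y| <= r]%R) `|f x - g x|%:E)%E.

Definition in_L1_Linfty (R : realType) (f : R -> R) : Prop :=
  f \in Lfun (leb R) 1%E /\ f \in Lfun (leb R) +oo%E.

Definition dx (R : realType) (f : R * R -> R) : R * R -> R :=
  fun z => 'D_((1, 0) : R * R) f z.

Definition dt (R : realType) (f : R * R -> R) : R * R -> R :=
  fun z => 'D_((0, 1) : R * R) f z.

(* s lists the successive partial derivatives: true for dx, false for dt. *)
Definition iter_partial (R : realType) (s : seq bool) (f : R * R -> R) :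
    R * R -> R :=
  foldr (fun b g => if b then dx g else dt g) f s.

Definition smooth2 (R : realType) (f : R * R -> R) : Prop :=
  forall s : seq bool,
    continuous (iter_partial s f) /\
    forall z : R * R, derivable (iter_partial s f) z ((1, 0) : R * R) /\
                      derivable (iter_partial s f) z ((0, 1) : R * R).

Definition smooth1 (R : realType) (f : R -> R) : Prop :=
  forall (n : nat) (x : R), derivable (derive1n n f) x 1.

Definition compact_support_in (R : realType) (T : topologicalType) (O : set T)
    (f : T -> R) : Prop :=
  exists K : set T, [/\ compact K, K `<=` O & forall z, ~ K z -> f z = 0].

Definition test2 (R : realType) (eta : R * R -> R) : Prop :=
  smooth2 eta /\ compact_support_in (halfplane R) eta.

Definition test1 (R : realType) (eta : R -> R) : Prop :=
  smooth1 eta /\ compact_support_in setT eta.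

Definition nonneg_Linfty_halfplane (R : realType) (u : R * R -> R) : Prop :=
  measurable_fun (halfplane R) u /\
  exists M : R, {ae leb2 R, forall z, halfplane R z -> 0 <= u z <= M}.

Definition entropy_ineq (R : realType) (m : R) (phi : R -> R)
    (u : R * R -> R) : Prop :=
  forall (k : R) (eta : R * R -> R), 0 <= k -> test2 eta ->
    (forall z, 0 <= eta z) ->
    0 <= \int[leb2 R]_(z in halfplane R)
           (`|u z - k| * dt eta z + `|u z `^ m - k `^ m| * dx eta z
            + Num.sg (u z - k) * phi (u z) * eta z).

Definition initial_trace_L1loc (R : realType) (u : R * R -> R) (u0 : R -> R) :
    Prop :=
  exists E : set R, (leb R).-negligible E /\
    forall r : R, 0 < r ->
      dist_L1 r (slice u t) u0 @[t --> within [set t | 0 < t /\ ~ E t] (nbhs 0)]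
        --> 0%E.

(* Solution of u_t + (u^m)_x = phi(u), u(., 0) = u0. *)
Definition kruzkov_solution (R : realType) (m : R) (phi : R -> R) (u0 : R -> R)
    (u : R * R -> R) : Prop :=
  [/\ nonneg_Linfty_halfplane u,
      entropy_ineq m phi u
    & initial_trace_L1loc u u0].

Definition continuous_L1loc (R : realType) (u : R * R -> R) : Prop :=
  (forall t : R, 0 < t -> locally_integrable setT (slice u t)) /\
  forall r t0 : R, 0 < r -> 0 < t0 ->
    dist_L1 r (slice u t) (slice u t0) @[t --> t0] --> 0%E.

(* U_a --> V in C([t0, T]; L^1_loc(R)) as a --> +oo, for all T > t0 > 0. *)
Definition cvg_C_L1loc (R : realType) (U : R -> R * R -> R) (V : R * R -> R) :
    Prop :=
  [/\ measurable_fun (halfplane R) V,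
      continuous_L1loc V
    & forall r t0 T : R, 0 < r -> 0 < t0 -> t0 < T ->
        ereal_sup [set dist_L1 r (slice (U a) t) (slice V t) | t in `[t0, T]]
          @[a --> +oo] --> 0%E].

Definition cvg_L1loc_halfplane (R : realType) (U : R -> R * R -> R)
    (V : R * R -> R) : Prop :=
  forall K : set (R * R), compact K -> K `<=` halfplane R ->
    (\int[leb2 R]_(z in K) `|U a z - V z|%:E)%E @[a --> +oo] --> 0%E.

Definition weak_cvg_L1loc_halfplane (R : realType) (U : R -> R * R -> R)
    (V : R * R -> R) : Prop :=
  forall g : R * R -> R, measurable_fun setT g ->
    (exists M : R, forall z, `|g z| <= M) ->
    compact_support_in (halfplane R) g ->
    (\int[leb2 R]_(z in halfplane R) (U a z * g z)) @[a --> +oo] -->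
      \int[leb2 R]_(z in halfplane R) (V z * g z).

(* u_t = - u^p in D'(R x (0, oo)). *)
Definition absorption_distrib (R : realType) (p : R) (u : R * R -> R) : Prop :=
  forall eta : R * R -> R, test2 eta ->
    - (\int[leb2 R]_(z in halfplane R) (u z * dt eta z)) =
    \int[leb2 R]_(z in halfplane R) (- (u z `^ p) * eta z).

(* v + psi_x = w in D'(R). *)
Definition add_deriv_distrib (R : realType) (v psi w : R -> R) : Prop :=
  forall eta : R -> R, test1 eta ->
    (\int[leb R]_x (v x * eta x)) - (\int[leb R]_x (psi x * derive1 eta x)) =
    \int[leb R]_x (w x * eta x).

(* 0 <= v <= 1 and v + psi_x = w for some 0 <= psi vanishing on {v < 1}. *)
Definition stationary_limit (R : realType) (v w : R -> R) : Prop :=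
  [/\ measurable_fun setT v,
      {ae leb R, forall x, 0 <= v x <= 1}
    & exists psi : R -> R,
        [/\ {ae leb R, forall x, 0 <= psi x},
            in_L1_Linfty psi,
            add_deriv_distrib v psi w
          & {ae leb R, forall x, v x < 1 -> psi x = 0}]].

(* Main.v *)
Require Import Defs.
From HB Require Import structures.
From mathcomp Require Import all_boot all_order all_algebra.
From mathcomp Require Import all_classical all_reals all_analysis.
From mathcomp Require Import measurable_realfun.
From mathcomp Require Import ring lra.

(** Both limits rest on one remark: below a level k < 1 a high power is
    negligible, so the mass lying below level k hardly moves.

    For the conservation laws put w = min(u0, 1) and let u be the solution of
    u_t + (u^m)_x = 0 with u(., 0) = w.  As 0 <= w <= 1, the pair (w, 0)
    solves the stationary problem, and it is enough to show that u tends
    to w.  Adding the Kruzkov inequality at level k to the one at a level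
    above sup u gives min(u, k)_t + min(u^m, k^m)_x >= 0
    ([truncated_mass_weak]).  The flux here is at most k^m, whence, for every
    test function f >= 0,
      int min(u(t), k) f >= int min(w, k) f - t k^m int |f'|
    ([truncated_mass_ge]).  In the other direction no mass is created:
    int u(t) <= int w ([mass_le]).  Now replace w by constants k_i < 1 on the
    cells of a smooth partition of unity phi_i
    ([smooth_step_approximation]).  Since |u - k| = u + k - 2 min(u, k), the
    two bounds together give
      sum_i int |u(t) - k_i| phi_i <= sum_i int |w - k_i| phi_i + small
    ([flow_cell_estimate]), the small terms being the mass of w off the cells
    and multiples of k_i^m, which vanish as m tends to infinity.  So u(t) tends to w in L^1_loc, uniformly for t in bounded
    intervals ([flow_L1_small], [strong_limit]).

    For the absorption problems, u_t = -u^p tested with products of functions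
    of x and of t becomes a statement at almost every x: for s <= t,
    u(s) - (t - s) u(s)^p <= u(t) <= u(s)
    ([absorption_nincr], [absorption_euler]).  Iterating the lower bound over
    ever finer subdivisions of [s, t], which is the explicit Euler scheme,
    gives min(u(s), k) - (t - s) k^p <= u(t) ([absorption_lower]), and s -> 0
    yields |u(t) - u(0)| <= (1 - k) + t k^p ([absorption_near_initial]).
    Letting p tend to infinity and then k to 1 proves the convergence, even
    locally uniformly in t ([weak_limit]).

    The passage from distributional inequalities to fixed times uses smooth
    plateaus in time ([plateau_increment]); together with the continuity of
    the solutions in L^1_loc it only requires test functions that are products
    f(x) g(t). *)

Import Order.TTheory GRing.Theory Num.Theory.
Import numFieldNormedType.Exports.

Local Open Scope classical_set_scope.
Local Open Scope ring_scope.

Set Implicit Arguments.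
Unset Strict Implicit.
Unset Printing Implicit Defensive.

(** * Smooth functions of one variable *)

(** Being derivable n times, with the derivative given as a witness: unlike
    iterated [derive1], this form lends itself to inductions on n. *)
Fixpoint n_derivable (R : realType) (n : nat) (f : R -> R) : Prop :=
  if n is k.+1 then
    exists df, (forall x : R, is_derive x 1 f (df x)) /\ n_derivable k df
  else True.

Lemma derive1_eq (R : realType) (f df : R -> R) :
  (forall x : R, is_derive x 1 f (df x)) -> f^`()%classic = df.
Proof.
by move=> h; apply/funext => x; rewrite derive1E (@derive_val _ _ _ _ _ _ _ (h x)).
Qed.

Lemma derive1_is_derive (R : realType) (f : R -> R) (x : R) :
  derivable f x 1 -> is_derive x 1 f (f^`()%classic x).
Proof. by move=> h; rewrite derive1E; exact/derivableP. Qed.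

Lemma smooth1P (R : realType) (f : R -> R) :
  smooth1 f <-> forall n, n_derivable n f.
Proof.
split=> [sf n|nf].
  elim: n f sf => [//|n IH] f sf; exists f^`()%classic; split.
    by move=> x; apply: derive1_is_derive; exact: (sf 0%N).
  by apply: IH => k x; rewrite -derive1Sn; exact: sf.
move=> n; elim: n f nf => [|n IH] f nf x.
  by have [df [h _]] := nf 1%N; have [] := h x.
rewrite derive1Sn; apply: IH => k.
by have [df [h]] := nf k.+1; rewrite (derive1_eq h).
Qed.

Lemma smooth1_derivable (R : realType) (f : R -> R) (x : R) :
  smooth1 f -> derivable f x 1.
Proof. by move=> /(_ 0%N x). Qed.

Lemma smooth1_derive (R : realType) (f : R -> R) :
  smooth1 f -> smooth1 f^`()%classic.
Proof. by move=> sf n x; rewrite -derive1Sn; exact: sf. Qed.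

Lemma smooth1_is_derive (R : realType) (f : R -> R) (x : R) :
  smooth1 f -> is_derive x 1 f (f^`()%classic x).
Proof. by move=> sf; apply: derive1_is_derive; exact: smooth1_derivable. Qed.

Lemma smooth1_continuous (R : realType) (f : R -> R) :
  smooth1 f -> continuous f.
Proof.
move=> sf x; apply: differentiable_continuous; apply/derivable1_diffP.
exact: smooth1_derivable.
Qed.

Lemma n_derivableW (R : realType) n (f : R -> R) :
  n_derivable n.+1 f -> n_derivable n f.
Proof.
elim: n f => [//|n IH] f [df [h nf]].
by exists df; split => //; exact: IH.
Qed.

Lemma n_derivable_cst (R : realType) n (c : R) : n_derivable n (fun=> c).
Proof.
elim: n c => [//|n IH] c; exists (fun=> 0); split => // x; exact: is_derive_cst.
Qed.

Lemma n_derivableD (R : realType) n (f g : R -> R) :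
  n_derivable n f -> n_derivable n g -> n_derivable n (fun x => f x + g x).
Proof.
elim: n f g => [//|n IH] f g [df [hf nf]] [dg [hg ng]].
exists (fun x => df x + dg x); split; last exact: IH.
by move=> x; apply: is_deriveD.
Qed.

Lemma n_derivableM (R : realType) n (f g : R -> R) :
  n_derivable n f -> n_derivable n g -> n_derivable n (fun x => f x * g x).
Proof.
elim: n f g => [//|n IH] f g nf ng.
have nf' := n_derivableW nf; have ng' := n_derivableW ng.
case: nf ng => [df [hf nf]] [dg [hg ng]].
exists (fun x => f x * dg x + g x * df x); split.
  by move=> x; apply: is_deriveM.
by apply: n_derivableD; exact: IH.
Qed.

Lemma n_derivableV (R : realType) n (f : R -> R) : (forall x, f x != 0) ->
  n_derivable n f -> n_derivable n (fun x => (f x)^-1).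
Proof.
move=> f0; elim: n => [//|n IH] nf.
have nf' := n_derivableW nf; case: nf => [df [hf nf]].
exists (fun x => -1 * ((f x)^-1 * (f x)^-1) * df x); split.
  move=> x; have := is_deriveV (f0 x) (hf x).
  by rewrite expr2 invfM mulN1r.
apply: n_derivableM => //; apply: n_derivableM; first exact: n_derivable_cst.
by apply: n_derivableM; exact: IH.
Qed.

Lemma n_derivable_affine (R : realType) n (f : R -> R) (a b : R) :
  n_derivable n f -> n_derivable n (fun x => f (a * x + b)).
Proof.
elim: n f => [//|n IH] f [df [hf nf]].
exists (fun x => df (a * x + b) * a); split; last first.
  by apply: n_derivableM; [exact: IH|exact: n_derivable_cst].
move=> x; apply: is_derive1_comp.
have := is_deriveD (is_deriveZ a (is_derive_id x 1)) (is_derive_cst b x (1 : R)).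
by rewrite addr0 /GRing.scale /= mulr1.
Qed.

Lemma n_derivable_expR (R : realType) n : n_derivable n (@expR R).
Proof. 
by elim: n => [//|n IH]; exists expR; split => // x; exact: is_derive_expR.
Qed.

Section smooth_closure.
Context (R : realType).
Implicit Types f g : R -> R.

Lemma smooth1_cst (c : R) : smooth1 (fun=> c).
Proof. by apply/smooth1P => n; exact: n_derivable_cst. Qed.

Lemma smooth1D f g : smooth1 f -> smooth1 g -> smooth1 (fun x => f x + g x).
Proof.
by move=> /smooth1P nf /smooth1P ng; apply/smooth1P => n; exact: n_derivableD.
Qed.

Lemma smooth1M f g : smooth1 f -> smooth1 g -> smooth1 (fun x => f x * g x).
Proof.
by move=> /smooth1P nf /smooth1P ng; apply/smooth1P => n; exact: n_derivableM.
Qed.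

Lemma smooth1Z (c : R) f : smooth1 f -> smooth1 (fun x => c * f x).
Proof. by move=> sf; apply: smooth1M => //; exact: smooth1_cst. Qed.

Lemma smooth1B f g : smooth1 f -> smooth1 g -> smooth1 (fun x => f x - g x).
Proof.
move=> sf sg; rewrite (_ : (fun _ => _) = (fun x => f x + -1 * g x)).
  by apply: smooth1D => //; exact: smooth1Z.
by apply/funext => x; rewrite mulN1r.
Qed.

Lemma smooth1V f : (forall x, f x != 0) -> smooth1 f ->
  smooth1 (fun x => (f x)^-1).
Proof. by move=> f0 /smooth1P nf; apply/smooth1P => n; exact: n_derivableV. Qed.

Lemma smooth1_affine f (a b : R) : smooth1 f -> smooth1 (fun x => f (a * x + b)).
Proof. by move=> /smooth1P nf; apply/smooth1P => n; exact: n_derivable_affine. Qed.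

Lemma smooth1_expR : smooth1 (@expR R).
Proof. by apply/smooth1P => n; exact: n_derivable_expR. Qed.

End smooth_closure.

(** * The flat function *)

(** P(1/x) exp(-1/x) on the positive half-line, extended by zero.  This class
    is stable under derivation, which makes exp(-1/x) smooth at the origin. *)
Definition flat (R : realType) (P : {poly R}) (x : R) : R :=
  if 0 < x then P.[x^-1] * expR (- x^-1) else 0.

(** exp(1/x) dominates every power of 1/x; one power is kept in reserve, so
    that the bound is linear and also controls difference quotients at 0. *)
Lemma flat_le (R : realType) (P : {poly R}) :
  exists2 C : R, 0 <= C & forall x, `|flat P x| <= C * `|x|.
Proof.
suff H : forall n, exists2 C : R, 0 <= C & forall x, `|flat (P * 'X^n) x| <= C * `|x|.
  by have := H 0%N; rewrite expr0 mulr1.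
(* the power 'X^n makes the induction on P go through *)
elim/poly_ind: P => [|P c IH] n.
  by exists 0 => // x; rewrite /flat mul0r horner0 mul0r if_same normr0 mul0r.
have [C C0 HC] := IH n.+1.
exists (C + `|c| * (n.+1)`!%:R); first by rewrite addr_ge0// mulr_ge0.
move=> x; rewrite [leRHS]mulrDl.
have -> : flat ((P * 'X + c%:P) * 'X^n) x =
    flat (P * 'X^(n.+1)) x + c * flat 'X^n x.
  rewrite /flat; case: ifPn => _; last by rewrite mulr0 addr0.
  by rewrite !hornerE /= exprS; ring.
apply: le_trans (ler_normD _ _) _; apply: lerD => //.
rewrite normrM -mulrA ler_wpM2l//.
rewrite /flat; case: ifPn => x0; last by rewrite normr0 mulr_ge0.
rewrite hornerXn ger0_norm; last first.
  by rewrite mulr_ge0 ?expR_ge0// exprn_ge0// invr_ge0 ltW.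
rewrite gtr0_norm// expRN ler_pdivrMr ?expR_gt0//.
have y0 : 0 < x^-1 by rewrite invr_gt0.
have := expR_ge1Dxn n (ltW y0).
set E := expR _ => hE.
have f0 : 0 < (n.+1)`!%:R :> R by rewrite ltr0n fact_gt0.
have {hE} : x^-1 ^+ n.+1 <= (n.+1)`!%:R * E.
  rewrite -ler_pdivrMl// mulrC; apply: le_trans hE; lra.
rewrite exprS -(ler_pM2l x0) mulrA divff ?gt_eqF// mul1r => h.
by rewrite [_ * x]mulrC -mulrA.
Qed.

Lemma flat_derive (R : realType) (P : {poly R}) (x : R) :
  is_derive x 1 (flat P) (flat ('X^2 * (P - P^`())) x).
Proof.
have [x0|x0|->] := ltgtP x 0.
- apply: (near_eq_is_derive (f := cst 0)); last first.
    by rewrite /flat ltNge ltW//=; exact: is_derive_cst.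
  near=> y; rewrite /flat /= ifF//; apply/negbTE; rewrite -leNgt ltW//.
  by near: y; exact: lt_nbhsl.
- apply: (@near_eq_is_derive R R R (fun y : R => P.[y^-1] * expR (- y^-1))).
    near=> y; rewrite /flat ifT//; near: y; exact: lt_nbhsr.
  rewrite /flat x0.
  have dV : is_derive x 1 (fun y : R => y^-1) (- x ^- 2).
    have := @is_deriveV R id x 1 1 (lt0r_neq0 x0) (is_derive_id _ _).
    by rewrite /GRing.scale/= mulr1.
  have dP : is_derive x 1 (fun y => P.[y^-1]) (P^`().[x^-1] * - x ^- 2).
    exact: (@is_derive1_comp _ (horner P) (fun y => y^-1)).
  have dE : is_derive x 1 (fun y : R => expR (- y^-1))
       (expR (- x^-1) * (- (- x ^- 2))).
    apply: (@is_derive1_comp _ expR (fun y => - y^-1)).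
  apply: (@is_derive_eq _ _ _ _ _ _ _ _ (is_deriveM dP dE)).
  by rewrite /GRing.scale /= !hornerE /= exprVn; ring.
(* at 0 the difference quotient of flat P is flat ('X * P), which tends to 0 *)
- have [C C0 hC] := flat_le ('X * P).
  rewrite {2}/flat ltxx.
  have key : (fun h : R => h^-1 *: (flat P (h *: (1:R) + 0) - flat P 0)) @ 0^' --> (0:R).
    apply/cvgr0Pnorm_le => e e0; near=> h.
    have h0 : h != 0 by near: h; exact: nbhs_dnbhs_neq.
    rewrite {2}/flat ltxx subr0 /GRing.scale/= mulr1 addr0.
    have -> : h^-1 * flat P h = flat ('X * P) h.
      by rewrite /flat; case: ifPn; rewrite ?mulr0// hornerM hornerX mulrA.
    apply: le_trans (hC h) _.
    apply: (@le_trans _ _ ((C + 1) * `|h|)).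
      by rewrite ler_wpM2r// lerDl.
    rewrite -ler_pdivlMl ?ltr_wpDl//.
    near: h; apply: dnbhs0_le; rewrite mulr_gt0// invr_gt0 ltr_wpDl//.
  apply: DeriveDef; first by apply/cvg_ex; exists 0.
  exact/cvg_lim.
Unshelve. all: by end_near. Qed.

Lemma smooth1_flat (R : realType) (P : {poly R}) : smooth1 (flat P).
Proof.
apply/smooth1P => n; elim: n P => [//|n IH] P.
by exists (flat ('X^2 * (P - P^`()))); split => // x; exact: flat_derive.
Qed.

(** * Smooth ramps *)

Lemma ndecr_derive1_ge0 (R : realType) (f : R -> R) (x : R) :
  derivable f x 1 -> {homo f : x y / x <= y} -> 0 <= f^`()%classic x.
Proof.
move=> df ndf; rewrite derive1E; apply: limr_ge; first exact: df.
near=> h; have h0 : h != 0 by near: h; exact: nbhs_dnbhs_neq.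
rewrite /GRing.scale/= mulr1; move: h0; rewrite neq_lt => /orP[h0|h0].
- by rewrite nmulr_rge0 ?invr_lt0// subr_le0 ndf// gerDr ltW.
- by rewrite pmulr_rge0 ?invr_gt0// subr_ge0 ndf// lerDr ltW.
Unshelve. all: by end_near. Qed.

Section smooth_step.
Context {R : realType}.
Implicit Types x y a b h : R.

Let e x : R := flat 1 x.

Let e_ge0 x : 0 <= e x.
Proof. by rewrite /e /flat hornerC mul1r; case: ifP => // _; exact: expR_ge0. Qed.

Let e_gt0 x : 0 < x -> 0 < e x.
Proof. by rewrite /e /flat hornerC mul1r => ->; exact: expR_gt0. Qed.

Let e_eq0 x : x <= 0 -> e x = 0.
Proof. by rewrite /e /flat ltNge => ->. Qed.

Let e_ndecr x y : x <= y -> e x <= e y.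
Proof.
have [x0|x0] := leP x 0; first by rewrite (e_eq0 x0) e_ge0.
move=> xy; have y0 := lt_le_trans x0 xy.
by rewrite /e /flat x0 y0 !hornerC !mul1r ler_expR lerN2 lef_pV2.
Qed.

Let den_gt0 x : 0 < e x + e (1 - x).
Proof.
have [x0|x0] := ltP 0 x; first by rewrite ltr_pwDl ?e_gt0.
by rewrite ltr_wpDl// e_gt0//; lra.
Qed.

Definition smooth_step x : R := flat 1 x / (flat 1 x + flat 1 (1 - x)).

Lemma smooth_step_smooth : smooth1 smooth_step.
Proof.
apply: smooth1M; first exact: smooth1_flat.
apply: smooth1V; first by move=> x; rewrite gt_eqF// den_gt0.
apply: smooth1D; first exact: smooth1_flat.
rewrite (_ : (fun _ => _) = (fun x : R => flat 1 (-1 * x + 1))).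
  exact/smooth1_affine/smooth1_flat.
by apply/funext => x; rewrite mulN1r addrC.
Qed.

Lemma smooth_step0 x : x <= 0 -> smooth_step x = 0.
Proof. by move=> x0; rewrite /smooth_step -/(e x) e_eq0// mul0r. Qed.

Lemma smooth_step1 x : 1 <= x -> smooth_step x = 1.
Proof.
move=> x1; rewrite /smooth_step -/(e x) -/(e (1 - x)) (@e_eq0 (1 - x)) ?addr0 ?subr_le0//.
by rewrite divff// gt_eqF// e_gt0// (lt_le_trans ltr01).
Qed.

Lemma smooth_step_ndecr x y : x <= y -> smooth_step x <= smooth_step y.
Proof.
move=> xy; rewrite /smooth_step -!/(e _).
rewrite ler_pdivrMr ?den_gt0// mulrAC ler_pdivlMr ?den_gt0//.
rewrite !mulrDr mulrC lerD2l; apply: ler_pM => //; first exact: e_ndecr.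
by apply: e_ndecr; lra.
Qed.

(** The argument is kept in the affine form for which smoothness is
    immediate. *)
Definition ramp a h x : R := smooth_step (h^-1 * x + - (h^-1 * a)).

Let ramp_arg a h x : h^-1 * x + - (h^-1 * a) = h^-1 * (x - a).
Proof. by rewrite mulrBr. Qed.

Lemma ramp_smooth a h : smooth1 (ramp a h).
Proof. exact: smooth1_affine smooth_step_smooth. Qed.

Lemma ramp_eq0 a h x : 0 < h -> x <= a -> ramp a h x = 0.
Proof.
move=> h0 xa; rewrite /ramp ramp_arg smooth_step0// mulr_ge0_le0//.
  by rewrite invr_ge0 ltW.
by rewrite subr_le0.
Qed.

Lemma ramp_eq1 a h x : 0 < h -> a + h <= x -> ramp a h x = 1.
Proof.
move=> h0 xa; rewrite /ramp ramp_arg smooth_step1// ler_pdivlMl//; lra.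
Qed.

Lemma ramp_ndecr a h x y : 0 < h -> x <= y -> ramp a h x <= ramp a h y.
Proof.
move=> h0 xy; apply: smooth_step_ndecr; rewrite lerD2r ler_wpM2l//.
by rewrite invr_ge0 ltW.
Qed.

Lemma ramp_ge0 a h x : 0 < h -> 0 <= ramp a h x.
Proof.
move=> h0; have [xa|/ltW xa] := leP x a; first by rewrite ramp_eq0.
by rewrite -(ramp_eq0 h0 (lexx a)) ramp_ndecr.
Qed.

Lemma ramp_le1 a h x : 0 < h -> ramp a h x <= 1.
Proof.
move=> h0; have [xa|/ltW xa] := leP (a + h) x; first by rewrite ramp_eq1.
by rewrite -(ramp_eq1 h0 (lexx (a + h))) ramp_ndecr.
Qed.

Lemma ramp_decr_start a b h x : 0 < h -> a <= b -> ramp b h x <= ramp a h x.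
Proof.
move=> h0 ab; rewrite /ramp; apply: smooth_step_ndecr.
by rewrite lerD2l lerN2 ler_wpM2l// invr_ge0 ltW.
Qed.

Lemma ramp_derive_ge0 a h x : 0 < h -> 0 <= (ramp a h)^`()%classic x.
Proof.
move=> h0; apply: ndecr_derive1_ge0; last by move=> y z; exact: ramp_ndecr.
by apply: smooth1_derivable; exact: ramp_smooth.
Qed.

Lemma ramp_derive_eq0 a h x : 0 < h -> x < a \/ a + h < x ->
  (ramp a h)^`()%classic x = 0.
Proof.
move=> h0 H; rewrite derive1E.
case: H => xa.
  rewrite (near_eq_derive (g := cst (0 : R^o))) ?derive_cst//.
  by near=> y; rewrite ramp_eq0// ltW//; near: y; exact: lt_nbhsl.
rewrite (near_eq_derive (g := cst (1 : R^o))) ?derive_cst//.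
by near=> y; rewrite ramp_eq1// ltW//; near: y; exact: lt_nbhsr.
Unshelve. all: by end_near. Qed.

End smooth_step.

(** * Products as test functions *)

Section tensor_tests.
Context {R : realType}.
Implicit Types f g : R -> R.

Definition tensor f g : R * R -> R := fun z => f z.1 * g z.2.

(** The difference quotient of a product along the first axis is that of its
    first factor, with the second factor frozen. *)
Lemma tensor_is_derive_dx f g (z : R * R) : smooth1 f ->
  is_derive z ((1, 0) : R * R) (tensor f g) (tensor f^`()%classic g z).
Proof.
move=> sf; have [df vf] := smooth1_is_derive z.1 sf.
have key : (fun h : R => h^-1 *: ((tensor f g \o shift z) (h *: ((1, 0) : R * R)) - tensor f g z))
    @ 0^' --> tensor f^`()%classic g z.
  rewrite (_ : (fun h => _) =
    fun h => (h^-1 *: ((f \o shift z.1) (h *: (1 : R)) - f z.1)) * g z.2).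
    apply: cvgM; last exact: cvg_cst.
    rewrite -vf; exact: df.
  apply/funext => h; rewrite /tensor /= /GRing.scale /= mulr0 add0r.
  by rewrite -mulrBl mulrA.
by apply: DeriveDef; [apply/cvg_ex; exists (tensor f^`()%classic g z)|exact/cvg_lim].
Qed.

Lemma tensor_is_derive_dt f g (z : R * R) : smooth1 g ->
  is_derive z ((0, 1) : R * R) (tensor f g) (tensor f g^`()%classic z).
Proof.
move=> sg; have [dg vg] := smooth1_is_derive z.2 sg.
have key : (fun h : R => h^-1 *: ((tensor f g \o shift z) (h *: ((0, 1) : R * R)) - tensor f g z))
    @ 0^' --> tensor f g^`()%classic z.
  rewrite (_ : (fun h => _) =
    fun h => f z.1 * (h^-1 *: ((g \o shift z.2) (h *: (1 : R)) - g z.2))).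
    apply: cvgM; first exact: cvg_cst.
    rewrite -vg; exact: dg.
  apply/funext => h; rewrite /tensor /= /GRing.scale /= mulr0 add0r.
  by rewrite -mulrBr mulrCA.
by apply: DeriveDef; [apply/cvg_ex; exists (tensor f g^`()%classic z)|exact/cvg_lim].
Qed.

Lemma dx_tensor f g : smooth1 f -> dx (tensor f g) = tensor f^`()%classic g.
Proof.
move=> sf; apply/funext => z; rewrite /dx.
by have [_ ->] := tensor_is_derive_dx g z sf.
Qed.

Lemma dt_tensor f g : smooth1 g -> dt (tensor f g) = tensor f g^`()%classic.
Proof.
move=> sg; apply/funext => z; rewrite /dt.
by have [_ ->] := tensor_is_derive_dt f z sg.
Qed.

(** Products are closed under both partial derivatives, so that only
    one-variable smoothness has to be known. *)
Lemma iter_partial_tensor (s : seq bool) f g : smooth1 f -> smooth1 g ->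
  exists f' g', [/\ smooth1 f', smooth1 g' &
    iter_partial s (tensor f g) = tensor f' g'].
Proof.
move=> sf sg; elim: s => [|[] s [f' [g' [sf' sg' E]]]]; first by exists f, g.
  exists f'^`()%classic, g'; split => //; first exact: smooth1_derive.
  by rewrite /= -/(iter_partial s _) E dx_tensor.
exists f', g'^`()%classic; split => //; first exact: smooth1_derive.
by rewrite /= -/(iter_partial s _) E dt_tensor.
Qed.

Lemma continuous_tensor f g : continuous f -> continuous g ->
  continuous (tensor f g).
Proof.
move=> cf cg z; apply: cvgM.
  by apply: continuous_comp; [exact: cvg_fst|exact: cf].
by apply: continuous_comp; [exact: cvg_snd|exact: cg].
Qed.

Lemma smooth2_tensor f g : smooth1 f -> smooth1 g -> smooth2 (tensor f g).
Proof.
move=> sf sg s; have [f' [g' [sf' sg' ->]]] := iter_partial_tensor s sf sg.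
split; first by apply: continuous_tensor; exact: smooth1_continuous.
move=> z; split.
  by have [] := tensor_is_derive_dx g' z sf'.
by have [] := tensor_is_derive_dt f' z sg'.
Qed.

Lemma test2_tensor f g (r a b : R) : smooth1 f -> smooth1 g -> 0 < a ->
  (forall x, r < `|x| -> f x = 0) ->
  (forall t, t < a \/ b < t -> g t = 0) ->
  test2 (tensor f g).
Proof.
move=> sf sg a0 f0 g0; split; first exact: smooth2_tensor.
exists (`[- r, r]%classic `*` `[a, b]%classic); split.
- by apply: compact_setX; exact: segment_compact.
- move=> z [_ /=]; rewrite in_itv/= => /andP[az _]; rewrite /halfplane/=.
  exact: lt_le_trans az.
- move=> z /not_andP[]/= /negP; rewrite in_itv/= negb_and -!ltNge /tensor => H.
    rewrite f0 ?mul0r// ltr_normr.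
    by move/orP: H => [H|H]; apply/orP; [right|left]; lra.
  by rewrite g0 ?mulr0//; move/orP: H.
Qed.

End tensor_tests.

(** * Bounded measurable functions *)

Definition bounded_mfun (R : realType) d (T : measurableType d) (f : T -> R) :=
  measurable_fun setT f /\ exists C : R, forall x, `|f x| <= C.

Definition bounded_support (R : realType) (f : R -> R) :=
  exists r : R, forall x, r < `|x| -> f x = 0.

Section bounded_mfun.
Context {R : realType} d (T : measurableType d).
Implicit Types f g : T -> R.

Lemma bounded_mfun_cst (c : R) : bounded_mfun (fun _ : T => c).
Proof. by split => //; exists `|c|. Qed.

Lemma bounded_mfunD f g : bounded_mfun f -> bounded_mfun g ->
  bounded_mfun (fun x => f x + g x).
Proof.
move=> [mf [C hC]] [mg [D hD]]; split; first exact: measurable_funD.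
by exists (C + D) => x; apply: le_trans (ler_normD _ _) _; exact: lerD.
Qed.

Lemma bounded_mfunM f g : bounded_mfun f -> bounded_mfun g ->
  bounded_mfun (fun x => f x * g x).
Proof.
move=> [mf [C hC]] [mg [D hD]]; split; first exact: measurable_funM.
by exists (C * D) => x; rewrite normrM ler_pM.
Qed.

Lemma bounded_mfunZ (c : R) f : bounded_mfun f -> bounded_mfun (fun x => c * f x).
Proof. by apply: bounded_mfunM; exact: bounded_mfun_cst. Qed.

Lemma bounded_mfunB f g : bounded_mfun f -> bounded_mfun g ->
  bounded_mfun (fun x => f x - g x).
Proof.
move=> [mf [C hC]] [mg [D hD]]; split; first exact: measurable_funB.
by exists (C + D) => x; apply: le_trans (ler_normB _ _) _; exact: lerD.
Qed.

Lemma bounded_mfun_norm f : bounded_mfun f -> bounded_mfun (fun x => `|f x|).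
Proof.
move=> [mf [C hC]]; split; first exact: measurableT_comp.
by exists C => x; rewrite normr_id.
Qed.

Lemma bounded_mfun_min f (c : R) : bounded_mfun f ->
  bounded_mfun (fun x => Num.min (f x) c).
Proof.
move=> [mf [C hC]]; split; first exact: measurable_minr.
exists (C + `|c|) => x; have := hC x; have := normr_ge0 c.
rewrite /Num.min; case: ifP; have := normr_ge0 (f x); lra.
Qed.

Lemma bounded_mfun_powR f (p : R) : 0 <= p -> (forall x, 0 <= f x) ->
  bounded_mfun f -> bounded_mfun (fun x => f x `^ p).
Proof.
move=> p0 f0 [mf [C hC]]; split.
  by apply: (measurableT_comp (measurable_powR p)).
exists (C `^ p) => x; rewrite ger0_norm ?powR_ge0//.
apply: ge0_ler_powR; rewrite ?nnegrE//.
  exact: le_trans (normr_ge0 _) (hC x).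
exact: le_trans (ler_norm _) (hC x).
Qed.

End bounded_mfun.

(** Most integrands below are of this kind, so that integrability is automatic
    and linearity can be used freely. *)
Definition tame (R : realType) (f : R -> R) := bounded_mfun f /\ bounded_support f.

Section tame.
Context {R : realType}.
Implicit Types f g : R -> R.
Local Notation mu := (leb R).

Lemma tameM f g : tame f -> bounded_mfun g -> tame (fun x => f x * g x).
Proof.
move=> [bf [r fr]] bg; split; first exact: bounded_mfunM.
by exists r => x rx; rewrite fr// mul0r.
Qed.

Lemma tameMl f g : bounded_mfun f -> tame g -> tame (fun x => f x * g x).
Proof.
move=> bf tg; rewrite (_ : (fun _ => _) = fun x => g x * f x); first exact: tameM.
by apply/funext => x; rewrite mulrC.
Qed.

Lemma tameZ (c : R) f : tame f -> tame (fun x => c * f x).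
Proof. by apply: tameMl; exact: bounded_mfun_cst. Qed.

Lemma tameD f g : tame f -> tame g -> tame (fun x => f x + g x).
Proof.
move=> [bf [r fr]] [bg [s gs]]; split; first exact: bounded_mfunD.
by exists (Num.max r s) => x; rewrite gt_max => /andP[? ?]; rewrite fr// gs// addr0.
Qed.

Lemma tameB f g : tame f -> tame g -> tame (fun x => f x - g x).
Proof.
move=> [bf [r fr]] [bg [s gs]]; split; first exact: bounded_mfunB.
by exists (Num.max r s) => x; rewrite gt_max => /andP[? ?]; rewrite fr// gs// subr0.
Qed.

Lemma tame_norm f : tame f -> tame (fun x => `|f x|).
Proof.
move=> [bf [r fr]]; split; first exact: bounded_mfun_norm.
by exists r => x rx; rewrite fr// normr0.
Qed.

Lemma tame_integrable f : tame f -> mu.-integrable setT (EFin \o f).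
Proof.
move=> [[mf [C hC]] [r fr]].
have fE : (EFin \o f) = (EFin \o f) \_ `[- r, r].
  apply/funext => x; rewrite patchE; case: ifPn => //.
  rewrite notin_setE/= in_itv/= => /negP; rewrite -ler_norml -ltNge => rx.
  by rewrite /= fr.
rewrite fE -integrable_mkcond//; apply: measurable_bounded_integrable => //.
- by rewrite /leb /= lebesgue_measure_itv/=; case: ifP => // _; rewrite -EFinB ltry.
- by apply: measurable_funTS.
- exists C; split; first exact: num_real.
  by move=> y Cy x _; exact: le_trans (hC x) (ltW Cy).
Qed.

Lemma integral_tameZ (c : R) f : tame f ->
  \int[mu]_x (c * f x) = c * \int[mu]_x f x.
Proof. by move=> tf; rewrite RintegralZl//; exact: tame_integrable. Qed.

Lemma integral_tameD f g : tame f -> tame g ->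
  \int[mu]_x (f x + g x) = \int[mu]_x f x + \int[mu]_x g x.
Proof. by move=> tf tg; rewrite RintegralD//; exact: tame_integrable. Qed.

Lemma integral_tameB f g : tame f -> tame g ->
  \int[mu]_x (f x - g x) = \int[mu]_x f x - \int[mu]_x g x.
Proof. by move=> tf tg; rewrite RintegralB//; exact: tame_integrable. Qed.

Lemma le_integral_tame f g : tame f -> tame g -> (forall x, f x <= g x) ->
  \int[mu]_x f x <= \int[mu]_x g x.
Proof.
by move=> tf tg fg; apply: le_Rintegral => //; exact: tame_integrable.
Qed.

Lemma continuous_tame f : continuous f -> bounded_support f -> tame f.
Proof.
move=> cf [r fr]; split; last by exists r.
split; first exact: continuous_measurable_fun.
have cK : compact [set f x | x in `[- r, r]%classic].
  apply: continuous_compact; last exact: segment_compact.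
  exact: continuous_subspaceT.
have [M [Mr hM]] := compact_bounded cK.
exists (`|M| + 1) => x; have [rx|xr] := ltP r `|x|.
  by rewrite fr// normr0 addr_ge0.
apply: hM; first by rewrite ltr_pwDr// ler_norm.
by exists x => //; rewrite /= in_itv/= -ler_norml.
Qed.

Lemma smooth1_tame f : smooth1 f -> bounded_support f -> tame f.
Proof. by move=> /smooth1_continuous; exact: continuous_tame. Qed.

Lemma derive1_bounded_support f : bounded_support f ->
  bounded_support f^`()%classic.
Proof.
move=> [r fr]; exists r => x rx; rewrite derive1E.
rewrite (near_eq_derive (g := cst (0 : R^o))) ?derive_cst//.
near=> y; rewrite fr//; near: y.
exact: (@cvgr_gt _ _ _ _ _ `|x| (@norm_continuous _ _ x)).
Unshelve. all: by end_near. Qed.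

Lemma derive1_tame f : smooth1 f -> bounded_support f -> tame f^`()%classic.
Proof.
move=> sf bf; apply: smooth1_tame; first exact: smooth1_derive.
exact: derive1_bounded_support.
Qed.

Lemma integral_derive1 f (a b : R) : smooth1 f -> a < b ->
  (forall x, x < a \/ b < x -> f^`()%classic x = 0) ->
  \int[mu]_x f^`()%classic x = f b - f a.
Proof.
move=> sf ab f'0.
have -> : \int[mu]_x f^`()%classic x = \int[mu]_(x in `[a, b]) f^`()%classic x.
  rewrite [RHS]Rintegral_mkcond; apply: eq_Rintegral => x _.
  rewrite patchE; case: ifPn => //.
  rewrite notin_setE/= in_itv/= => /negP; rewrite negb_and -!ltNge => /orP.
  exact: f'0.
rewrite /Rintegral (@continuous_FTC2 _ f^`()%classic f)//.
- by apply: continuous_subspaceT; apply: smooth1_continuous; exact: smooth1_derive.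
- split; first by move=> x _; exact: smooth1_derivable.
  + by apply: cvg_at_right_filter; exact: smooth1_continuous.
  + by apply: cvg_at_left_filter; exact: smooth1_continuous.
Qed.

Lemma integral_derive1_eq0 f : smooth1 f -> bounded_support f ->
  \int[mu]_x f^`()%classic x = 0.
Proof.
move=> sf fs; have [r fr] := fs.
have [s fs'] := derive1_bounded_support fs.
pose M := Num.max (Num.max r s) 0 + 1.
have rM : r < M by rewrite /M ltr_pwDr// !le_max lexx.
have sM : s < M by rewrite /M ltr_pwDr// !le_max lexx orbT.
have M0 : 0 < M by rewrite /M ltr_wpDl// le_max lexx orbT.
rewrite (@integral_derive1 _ (- M) M)//.
- by rewrite !fr ?subrr// ?normrN gtr0_norm.
- by rewrite -subr_gt0 opprK addr_gt0.
- move=> x H; apply: fs'; rewrite (lt_le_trans sM)// ler_normr.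
  by case: H => H; apply/orP; [right|left]; lra.
Qed.

Definition box r : R -> R := \1_(`[- r, r]%classic : set R).

Lemma boxE r x : box r x = (`|x| <= r)%R%:R.
Proof. by rewrite /box indicE mem_setE in_itv/= ler_norml. Qed.

Lemma box_ge0 r x : 0 <= box r x. Proof. by rewrite boxE ler0n. Qed.

Lemma box_le1 r x : box r x <= 1. Proof. by rewrite boxE lern1 leq_b1. Qed.

Lemma box_tame r : tame (box r).
Proof.
split; last by exists r => x rx; rewrite boxE leNgt rx.
split; first exact: measurable_indic.
by exists 1 => x; rewrite ger0_norm ?box_ge0 ?box_le1.
Qed.

End tame.

(** * Integrals over the half-plane of products *)

Section fubini.
Context {R : realType}.
Implicit Types (f g : R -> R) (G : R * R -> R).
Local Notation mu := (leb R).
Local Notation mu2 := (leb2 R).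

Lemma measurable_halfplane : measurable (halfplane R).
Proof.
rewrite (_ : halfplane R = setT `*` `]0, +oo[%classic).
  exact: measurableX.
by apply/seteqP; split => [z|z [_]]; rewrite /halfplane/= in_itv/= andbT.
Qed.

Lemma bounded_mfun_slice G (t : R) : bounded_mfun G ->
  bounded_mfun (fun x => G (x, t)).
Proof.
move=> [mG [C hC]]; split; first exact: measurable_fun_pair1.
by exists C => x; exact: hC.
Qed.

Definition slice_integral G f (t : R) : R := \int[mu]_x (G (x, t) * f x).

Lemma bounded_mfun_slice_integral G f : bounded_mfun G -> tame f ->
  bounded_mfun (slice_integral G f).
Proof.
move=> bG tf.
have tGf t : tame (fun x => G (x, t) * f x).
  by apply: tameMl => //; exact: bounded_mfun_slice.
case: (bG) => mG [C hC]; split; last first.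
  exists (C * \int[mu]_x `|f x|) => t.
  apply: le_trans; first by apply: le_normr_Rintegral => //; exact: tame_integrable.
  rewrite -RintegralZl//; last by apply: tame_integrable; exact: tame_norm.
  apply: le_Rintegral => //.
  - by apply: tame_integrable; apply: tame_norm.
  - by apply: tame_integrable; apply/tameZ/tame_norm.
  - by move=> x _; rewrite normrM ler_wpM2r.
pose F (z : R * R) := (G z * f z.1)%:E.
have mF : measurable_fun setT F.
  apply/measurable_EFinP; apply: measurable_funM => //.
  by case: (tf) => [[mf _] _]; exact: (measurableT_comp mf measurable_fst).
rewrite (_ : slice_integral G f = fine \o (fun t =>
   (\int[mu]_x (F^\+ (x, t)) - \int[mu]_x (F^\- (x, t)))%E)).
  apply: (measurableT_comp (fine_measurable measurableT)).
  apply: emeasurable_funB.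
  - apply: measurable_fun_fubini_tonelli_G => //; exact: measurable_funepos.
  - apply: measurable_fun_fubini_tonelli_G => //; exact: measurable_funeneg.
apply/funext => t; rewrite /slice_integral /Rintegral integralE/=.
by congr fine; congr (_ - _)%E; apply: eq_integral => x _;
  rewrite ?funeposE ?funenegE.
Qed.

(** The second factor vanishes at nonpositive times, so the integral over the
    half-plane is one over the whole plane, to which Fubini applies. *)
Lemma fubini_tensor G f g : bounded_mfun G -> tame f -> tame g ->
  (forall t, t <= 0 -> g t = 0) ->
  mu2.-integrable (halfplane R) (EFin \o (fun z => G z * tensor f g z)) /\
  \int[mu2]_(z in halfplane R) (G z * tensor f g z) =
  \int[mu]_t (slice_integral G f t * g t).
Proof.
move=> bG tf tg g0.
pose F (z : R * R) := G z * tensor f g z.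
have FE : (EFin \o F) \_ (halfplane R) = EFin \o F.
  apply/funext => z; rewrite patchE; case: ifPn => //.
  rewrite notin_setE /halfplane/= => /negP; rewrite -leNgt => z0.
  by rewrite /F /tensor g0// !mulr0.
have iF : mu2.-integrable setT (EFin \o F).
  case: (bG) (tf) (tg) => [mG [C hC]] [[mf [C1 hf]] [r fr]] [[mg [C2 hg]] [s gs]].
  pose B : set (R * R) := `[- r, r]%classic `*` `[- s, s]%classic.
  have mB : measurable B by exact: measurableX.
  have -> : EFin \o F = (EFin \o F) \_ B.
    apply/funext => z; rewrite patchE; case: ifPn => //.
    rewrite notin_setE => /not_andP[]/=; rewrite in_itv/= => /negP;
      rewrite -ler_norml -ltNge => H; rewrite /F /tensor /=.
      by rewrite fr// mul0r mulr0.
    by rewrite gs// !mulr0.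
  rewrite -(integrable_mkcond (mu := mu2) _ mB).
  apply: (measurable_bounded_integrable (mu := mu2) mB).
  - rewrite /leb2 /B /= product_measure1E//= !lebesgue_measure_itv/=.
    by case: ifP => _; case: ifP => _; rewrite ?mule0 ?mul0e// -!EFinB -EFinM ltry.
  - apply: measurable_funTS; apply: measurable_funM => //.
    apply: measurable_funM.
      exact: (measurableT_comp mf measurable_fst).
    exact: (measurableT_comp mg measurable_snd).
  - exists (C * (C1 * C2)); split; first exact: num_real.
    move=> y Cy z _; apply: le_trans (ltW Cy).
    by rewrite /F /tensor !normrM ler_pM// ler_pM.
split.
  by apply/(@integrable_mkcond _ _ _ mu2 _ _ measurable_halfplane); rewrite FE.
rewrite /Rintegral integral_mkcond FE -[X in fine X = _]integral21_prod_meas1//.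
congr fine; apply: eq_integral => t _; rewrite /fubini_G.
have iGf : mu.-integrable setT (EFin \o (fun x => G (x, t) * f x)).
  by apply: tame_integrable; apply: tameMl => //; exact: bounded_mfun_slice.
have iFt : mu.-integrable setT (EFin \o (fun x => F (x, t))).
  have -> : (fun x => F (x, t)) = fun x => (G (x, t) * f x) * g t.
    by apply/funext => x; rewrite /F /tensor/= mulrA.
  apply: tame_integrable; apply: tameM; last exact: bounded_mfun_cst.
  by apply: tameMl => //; exact: bounded_mfun_slice.
rewrite -[LHS]fineK; last exact: integrable_fin_num.
congr EFin; rewrite -/(Rintegral mu setT _) -RintegralZr//.
by apply: eq_Rintegral => x _; rewrite /F /tensor/= mulrA.
Qed.

End fubini.

(** Closure properties of bounded measurable functions, and of those with
    bounded support, applied as long as possible. *)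
Ltac bounded_mfun_tac := match goal with
  | H : bounded_mfun ?f |- bounded_mfun ?f => exact H
  | H : tame ?f |- bounded_mfun ?f => exact (proj1 H)
  | |- bounded_mfun (slice_integral ?G ?f) =>
      apply: (@bounded_mfun_slice_integral _ G f); [bounded_mfun_tac|tame_tac]
  | |- bounded_mfun (fun x => Num.norm _) => apply: bounded_mfun_norm; bounded_mfun_tac
  | |- bounded_mfun (fun x => _ + - _) => apply: bounded_mfunB; bounded_mfun_tac
  | |- bounded_mfun (fun x => _ + _) => apply: bounded_mfunD; bounded_mfun_tac
  | |- bounded_mfun (fun x => _ * _) => apply: bounded_mfunM; bounded_mfun_tac
  | |- bounded_mfun (fun x => Num.min _ _) => apply: bounded_mfun_min; bounded_mfun_tac
  | |- bounded_mfun (fun x => ?G (x, ?t)) => apply: (@bounded_mfun_slice _ G t); bounded_mfun_tac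
  | |- bounded_mfun (fun x => ?c) => exact: bounded_mfun_cst
  | H : forall t, bounded_mfun _ |- bounded_mfun _ => exact (H _)
  end
with tame_tac := match goal with
  | H : tame ?f |- tame ?f => exact H
  | |- tame (box _) => exact: box_tame
  | |- tame (fun x => Num.norm _) => apply: tame_norm; tame_tac
  | |- tame (fun x => _ + - _) => apply: tameB; tame_tac
  | |- tame (fun x => _ + _) => apply: tameD; tame_tac
  | |- tame (fun x => _ * _) => first
      [ apply: tameMl; [solve [bounded_mfun_tac]|solve [tame_tac]]
      | apply: tameM; [solve [tame_tac]|solve [bounded_mfun_tac]] ]
  end.

(** * From distributional to pointwise-in-time inequalities *)

Section plateau.
Context {R : realType}.
Implicit Types (B : R -> R) (a b h x : R).
Local Notation mu := (leb R).

Lemma ramp_derive_bounded_support a h : 0 < h ->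
  bounded_support (ramp a h)^`()%classic.
Proof.
move=> h0; exists (`|a| + h) => x Hx; apply: ramp_derive_eq0 => //.
have := ler_norm a; have := ler_norm (- a); rewrite normrN => ? ?.
by have [x0|x0] := leP 0 x; [rewrite (ger0_norm x0) in Hx; right|
  rewrite (ltr0_norm x0) in Hx; left]; lra.
Qed.

Lemma ramp_derive_tame a h : 0 < h -> tame (ramp a h)^`()%classic.
Proof.
move=> h0; apply: smooth1_tame; last exact: ramp_derive_bounded_support.
apply: smooth1_derive; exact: ramp_smooth.
Qed.

(** The derivative of a ramp is a probability density concentrated on
    [a, a + h]: integrating against it averages over that interval. *)
Lemma integral_ramp_derive a h : 0 < h -> \int[mu]_x (ramp a h)^`()%classic x = 1.
Proof.
move=> h0; rewrite (@integral_derive1 _ _ a (a + h)).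
- by rewrite ramp_eq1// ramp_eq0// subr0.
- exact: ramp_smooth.
- by rewrite ltrDl.
- by move=> x; exact: ramp_derive_eq0.
Qed.

Lemma integral_mul_ramp_derive_le B a h (c : R) : 0 < h -> bounded_mfun B ->
  (forall x, a <= x <= a + h -> B x <= c) ->
  \int[mu]_x (B x * (ramp a h)^`()%classic x) <= c.
Proof.
move=> h0 bB Bc; rewrite -[leRHS]mulr1 -(integral_ramp_derive a h0).
have tr := ramp_derive_tame a h0.
rewrite -RintegralZl//; last exact: tame_integrable.
apply: le_Rintegral => //.
- by apply: tame_integrable; exact: tameMl.
- by apply: tame_integrable; exact: tameZ.
move=> x _; have [ax|] := boolP (a <= x <= a + h).
  by rewrite ler_wpM2r ?Bc// ramp_derive_ge0.
by rewrite negb_and -!ltNge => /orP ax; rewrite ramp_derive_eq0// !mulr0.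
Qed.

Lemma integral_mul_ramp_derive_ge B a h (c : R) : 0 < h -> bounded_mfun B ->
  (forall x, a <= x <= a + h -> c <= B x) ->
  c <= \int[mu]_x (B x * (ramp a h)^`()%classic x).
Proof.
move=> h0 bB Bc; rewrite -[leLHS]mulr1 -(integral_ramp_derive a h0).
have tr := ramp_derive_tame a h0.
rewrite -RintegralZl//; last exact: tame_integrable.
apply: le_Rintegral => //.
- by apply: tame_integrable; exact: tameZ.
- by apply: tame_integrable; exact: tameMl.
move=> x _; have [ax|] := boolP (a <= x <= a + h).
  by rewrite ler_wpM2r ?Bc// ramp_derive_ge0.
by rewrite negb_and -!ltNge => /orP ax; rewrite ramp_derive_eq0// !mulr0.
Qed.

Definition plateau a b h x : R := ramp a h x - ramp b h x.

Lemma plateau_smooth a b h : smooth1 (plateau a b h).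
Proof. by apply: smooth1B; exact: ramp_smooth. Qed.

Lemma plateau_ge0 a b h x : 0 < h -> a <= b -> 0 <= plateau a b h x.
Proof. by move=> h0 ab; rewrite subr_ge0 ramp_decr_start. Qed.

Lemma plateau_le1 a b h x : 0 < h -> plateau a b h x <= 1.
Proof.
move=> h0; rewrite /plateau; have := ramp_le1 a x h0; have := ramp_ge0 b x h0; lra.
Qed.

Lemma plateau_eq0 a b h x : 0 < h -> a <= b -> x <= a \/ b + h <= x ->
  plateau a b h x = 0.
Proof.
move=> h0 ab [xa|xb]; rewrite /plateau.
  by rewrite !ramp_eq0 ?subrr// (le_trans xa).
by rewrite !ramp_eq1 ?subrr// (le_trans _ xb)// lerD2r.
Qed.

Lemma plateau_bounded_support a b h : 0 < h -> a <= b ->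
  bounded_support (plateau a b h).
Proof.
move=> h0 ab; exists (`|a| + `|b| + h) => x Hx; apply: plateau_eq0 => //.
have := ler_norm b; have := ler_norm (- a); rewrite normrN.
have := normr_ge0 a; have := normr_ge0 b => ? ? ? ?.
by have [x0|x0] := leP 0 x; [rewrite (ger0_norm x0) in Hx; right|
  rewrite (ltr0_norm x0) in Hx; left]; lra.
Qed.

Lemma plateau_tame a b h : 0 < h -> a <= b -> tame (plateau a b h).
Proof.
by move=> h0 ab; apply: smooth1_tame; [exact: plateau_smooth|exact: plateau_bounded_support].
Qed.

Lemma derive1_plateau a b h : (plateau a b h)^`()%classic =
  fun x => (ramp a h)^`()%classic x - (ramp b h)^`()%classic x.
Proof.
apply: derive1_eq => x.
by apply: is_deriveB; apply: smooth1_is_derive; exact: ramp_smooth.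
Qed.

Lemma integral_plateau_le a b h : 0 < h -> a <= b ->
  \int[mu]_x plateau a b h x <= b - a + h.
Proof.
move=> h0 ab.
have -> : \int[mu]_x plateau a b h x = \int[mu]_(x in `[a, b + h]) plateau a b h x.
  rewrite [RHS]Rintegral_mkcond; apply: eq_Rintegral => x _.
  rewrite patchE; case: ifPn => //.
  rewrite notin_setE/= in_itv/= => /negP; rewrite negb_and -!ltNge => /orP H.
  by rewrite plateau_eq0//; case: H => /ltW; [left|right].
have abh : a < b + h by rewrite ltr_pwDr.
have mab : fine (mu `[a, b + h]%classic) = b - a + h.
  by rewrite /leb /= lebesgue_measure_itv/= lte_fin abh -EFinB/=; ring.
rewrite -mab -[leRHS]mul1r -Rintegral_cst//.
apply: le_Rintegral => //.
- apply: integrableS (tame_integrable (plateau_tame h0 ab)) => //.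
- apply/(@measurable_bounded_integrable _ _ _ mu) => //.
  + by rewrite /leb /= lebesgue_measure_itv/= lte_fin abh -EFinB ltry.
  + by exists 1; split => // y y1 x _ /=; rewrite normr1 ltW.
- by move=> x _; exact: plateau_le1.
Qed.

(** Testing a distributional inequality with ever steeper plateaus evaluates
    it between two given times. *)
Lemma plateau_increment (B : R -> R) (a C : R) : bounded_mfun B -> 0 <= C ->
  (forall t, a < t -> {for t, continuous B}) ->
  (forall s t h, a < s -> s < t -> 0 < h ->
    \int[mu]_x (B x * (plateau s t h)^`()%classic x) <=
      C * \int[mu]_x plateau s t h x) ->
  forall s t, a < s -> s <= t -> B s - B t <= C * (t - s).
Proof.
move=> bB C0 cB H s t as_; rewrite le_eqVlt => /predU1P[->|st].
  by rewrite !subrr mulr0.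
apply/ler_addgt0Pr => e e0.
have e3 : 0 < e / 3 by rewrite divr_gt0.
have at_ : a < t by exact: lt_trans st.
have near_h u : a < u -> \forall h \near 0^'+, forall x, u <= x <= u + h -> `|B u - B x| <= e / 3.
  move=> au; have /cvgrPdist_le/(_ _ e3) := cB _ au.
  move=> /nbhs_ballP[d /= d0 Hd]; near=> h => x /andP[ux xu].
  apply: Hd; rewrite /ball/= distrC ger0_norm ?subr_ge0//.
  have : h < d by near: h; exact: nbhs_right_lt.
  lra.
have [h [h0 hs ht hC]] : exists h, [/\ 0 < h,
    forall x, s <= x <= s + h -> `|B s - B x| <= e / 3,
    forall x, t <= x <= t + h -> `|B t - B x| <= e / 3 & C * h <= e / 3].
  near (0:R)^'+ => h; exists h; split.
  - by near: h; exact: nbhs_right_gt.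
  - by near: h; exact: near_h.
  - by near: h; exact: near_h.
  - apply: (@le_trans _ _ ((C + 1) * h)).
      by rewrite ler_wpM2r ?lerDl.
    rewrite -ler_pdivlMl ?ltr_wpDl//.
    by near: h; apply: nbhs_right_le; rewrite mulr_gt0// invr_gt0 ltr_wpDl.
have {H} := H _ _ _ as_ st h0; rewrite derive1_plateau.
under eq_Rintegral do rewrite mulrBr.
rewrite RintegralB//; last 2 first.
  by apply: tame_integrable; apply: tameMl => //; exact: ramp_derive_tame.
  by apply: tame_integrable; apply: tameMl => //; exact: ramp_derive_tame.
have P3 : B s - e / 3 <= \int[mu]_x (B x * (ramp s h)^`()%classic x).
  apply: integral_mul_ramp_derive_ge => // x /hs.
  by rewrite ler_distlC => /andP[].
have P2 : \int[mu]_x (B x * (ramp t h)^`()%classic x) <= B t + e / 3.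
  apply: integral_mul_ramp_derive_le => // x /ht.
  by rewrite ler_distlC => /andP[].
have P1 := ler_wpM2l C0 (integral_plateau_le h0 (ltW st)).
rewrite mulrDr in P1 => P4.
have arith : forall x y z i j k l d : R, x - d <= i -> j <= y + d -> z <= l + k ->
    k <= d -> i - j <= z -> x - y <= l + 3 * d.
  by clear; move=> x y z i j k l d; lra.
have -> : e = 3 * (e / 3) by rewrite mulrCA divff ?mulr1.
exact: (arith _ _ _ _ _ _ _ _ P3 P2 P1 hC P4).
Unshelve. all: by end_near. Qed.

End plateau.

(** * Convergence in L^1 on bounded intervals *)

Section L1_distance.
Context {R : realType}.
Implicit Types (p q f : R -> R) (r : R).
Local Notation mu := (leb R).

(** Makes the arithmetic of real-valued integrals available for distances. *)
Lemma dist_L1E r p q : bounded_mfun p -> bounded_mfun q ->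
  dist_L1 r p q = (\int[mu]_x (`|p x - q x| * box r x))%:E.
Proof.
move=> bp bq; rewrite /dist_L1.
have t : tame (fun x => `|p x - q x| * box r x).
  apply: tameMl; last exact: box_tame.
  by apply: bounded_mfun_norm; exact: bounded_mfunB.
rewrite /Rintegral fineK; last exact/integrable_fin_num/tame_integrable.
rewrite [LHS]integral_mkcond. apply: eq_integral => x _.
rewrite patchE boxE; case: ifPn; rewrite ?notin_setE ?inE /=.
  by move=> ->; rewrite mulr1.
by move=> /negP/negbTE ->; rewrite mulr0.
Qed.

Lemma tame_le_box f : tame f -> exists r C : R, [/\ 0 < r, 0 < C &
  forall x, `|f x| <= C * box r x].
Proof.
move=> [[_ [C hC]] [r fr]]; exists (`|r| + 1), (`|C| + 1); split.
- by rewrite ltr_wpDl.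
- by rewrite ltr_wpDl.
move=> x; rewrite boxE; case: (leP `|x| (`|r| + 1)) => H /=.
  by rewrite mulr1 (le_trans (hC x))// (le_trans (ler_norm _))// lerDl.
by rewrite mulr0 fr ?normr0// (le_lt_trans _ H)// (le_trans (ler_norm _))// lerDl.
Qed.

Lemma integral_diff_le p q f r (C : R) : bounded_mfun p -> bounded_mfun q ->
  tame f -> (forall x, `|f x| <= C * box r x) ->
  (`|\int[mu]_x (p x * f x) - \int[mu]_x (q x * f x)|%:E <=
    C%:E * dist_L1 r p q)%E.
Proof.
move=> bp bq tf fC; rewrite dist_L1E// -EFinM lee_fin.
have bd : bounded_mfun (fun x => `|p x - q x|).
  by apply: bounded_mfun_norm; exact: bounded_mfunB.
rewrite -RintegralB//; [|exact/tame_integrable/tameMl..].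
apply: le_trans; first apply: le_normr_Rintegral => //.
  by apply: tame_integrable; apply: tameB; exact: tameMl.
rewrite -RintegralZl//; last by apply/tame_integrable/tameMl => //; exact: box_tame.
apply: le_Rintegral => //.
- by apply: tame_integrable; apply: tame_norm; apply: tameB; exact: tameMl.
- by apply/tame_integrable/tameZ/tameMl => //; exact: box_tame.
move=> x _; rewrite -mulrBl normrM mulrCA ler_wpM2l//.
Qed.

(** Turns continuity in L^1_loc and the initial condition into statements about
    weighted integrals of slices. *)
Lemma L1loc_cvg_integral (T : Type) (F : set_system T) {FF : ProperFilter F}
    (g : T -> R -> R) q f : bounded_mfun q -> tame f ->
  (\forall t \near F, bounded_mfun (g t)) ->
  (forall r, 0 < r -> dist_L1 r (g t) q @[t --> F] --> 0%E) ->
  \int[mu]_x (g t x * f x) @[t --> F] --> \int[mu]_x (q x * f x).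
Proof.
move=> bq tf bg gq; have [r [C [r0 C0 fC]]] := tame_le_box tf.
have H : (`|\int[mu]_x (g t x * f x) - \int[mu]_x (q x * f x)|%:E)%E
    @[t --> F] --> 0%:E.
  apply: (@squeeze_cvge _ _ _ _ (cst 0%E) _ (fun t => C%:E * dist_L1 r (g t) q)%E).
  - near=> t; rewrite lee_fin normr_ge0/=; apply: integral_diff_le => //.
    by near: t.
  - exact: cvg_cst.
  - by rewrite -[X in _ --> X](mule0 C%:E); apply: cvgeZl => //; exact: gq.
move/fine_cvg: H => H; apply/cvgrPdist_le => e e0; move/cvgrPdist_le: H => /(_ _ e0).
by apply: filterS => t /=; rewrite distrC subr0 normr_id distrC.
Unshelve. all: by end_near. Qed.

Lemma continuous_slice_integral (G : R * R -> R) f : bounded_mfun G -> tame f ->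
  continuous_L1loc G ->
  forall t, 0 < t -> {for t, continuous (slice_integral G f)}.
Proof.
move=> bG tf [_ cG] t t0.
apply: (@L1loc_cvg_integral _ (nbhs t) _ (fun t x => G (x, t)) (fun x => G (x, t))) => //.
- exact: bounded_mfun_slice.
- by apply: nearW => s; exact: bounded_mfun_slice.
- by move=> r r0; exact: cG.
Qed.

Lemma measurable_abs_ball r : measurable ([set y | `|y| <= r] : set R).
Proof.
rewrite (_ : [set y | _] = `[- r, r]%classic)//.
by apply/seteqP; split => x /=; rewrite in_itv/= ler_norml.
Qed.

Lemma le_dist_L1 r p q p' q' : measurable_fun setT p -> measurable_fun setT q ->
  measurable_fun setT p' -> measurable_fun setT q' ->
  (forall x, `|p x - q x| <= `|p' x - q' x|) ->
  (dist_L1 r p q <= dist_L1 r p' q')%E.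
Proof.
move=> mp mq mp' mq' H; apply: ge0_le_integral => //.
- exact: measurable_abs_ball.
- apply/measurable_EFinP/measurable_funTS.
  by apply: measurableT_comp => //; exact: measurable_funB.
- apply/measurable_EFinP/measurable_funTS.
  by apply: measurableT_comp => //; exact: measurable_funB.
- by move=> x _; rewrite lee_fin H.
Qed.

Lemma bounded_locally_integrable p : bounded_mfun p -> locally_integrable setT p.
Proof.
move=> [mp [C hC]]; split => //; first exact: openT.
move=> K _ cK; have mK := compact_measurable cK.
have : mu.-integrable K (EFin \o p).
  apply: (measurable_bounded_integrable (mu := mu) mK).
  - exact: compact_finite_measure.
  - exact: measurable_funTS.
  - exists C; split; first exact: num_real.
    by move=> y Cy x _; exact: le_trans (hC x) (ltW Cy).
by move=> /integrableP[].
Qed.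

(** Truncating to [0, M] and extending by zero gives an everywhere bounded
    representative, so that slices at every positive time are bounded. *)
Definition truncation (M : R) (u : R * R -> R) : R * R -> R :=
  fun z => if 0 < z.2 then Num.min (Num.max (u z) 0) M else 0.

Lemma truncation_itv M u z : 0 <= M -> 0 <= truncation M u z <= M.
Proof.
move=> M0; rewrite /truncation; case: ifP => _; last by rewrite lexx.
by rewrite le_min le_max lexx orbT M0 ge_min lexx orbT.
Qed.

Lemma truncation_id M u z : 0 < z.2 -> 0 <= u z <= M -> truncation M u z = u z.
Proof. by rewrite /truncation => -> /andP[u0 uM]; rewrite max_l// min_l. Qed.

Lemma truncation_bounded M u : 0 <= M -> measurable_fun (halfplane R) u ->
  bounded_mfun (truncation M u).
Proof.
move=> M0 mu_; split; last first.
  exists M => z; have /andP[u0 uM] := truncation_itv u z M0.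
  by rewrite ger0_norm.
rewrite (_ : truncation M u = (fun z => Num.min (Num.max (u z) 0) M) \_ (halfplane R)).
  apply: (measurable_restrictT _ _).1; first exact: measurable_halfplane.
  by apply: measurable_minr => //; exact: measurable_maxr.
apply/funext => z; rewrite patchE /truncation /halfplane.
by case: ifPn => z0; [rewrite mem_set|rewrite memNset// => /= H; rewrite H in z0].
Qed.

Lemma min_max_lipschitz (M a b : R) :
  `|Num.min (Num.max a 0) M - Num.min (Num.max b 0) M| <= `|a - b|.
Proof.
have H c d : c <= d ->
    `|Num.min (Num.max c 0) M - Num.min (Num.max d 0) M| <= `|c - d|.
  move=> cd; rewrite distrC [leRHS]distrC !ger0_norm ?subr_ge0//.
    rewrite /Num.max; do 2 case: ltP => ?; rewrite /Num.min; do ?[case: ltP => ?]; lra.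
  by rewrite le_min2// le_max2.
by have [ab|/ltW ab] := leP a b; [exact: H|rewrite distrC [leRHS]distrC; exact: H].
Qed.

Lemma truncation_continuous_L1loc M u : 0 <= M ->
  measurable_fun (halfplane R) u ->
  continuous_L1loc u -> continuous_L1loc (truncation M u).
Proof.
move=> M0 mu_ [lu cu]; have bT := truncation_bounded M0 mu_; split.
  by move=> t t0; apply: bounded_locally_integrable; exact: bounded_mfun_slice.
move=> r t0 r0 t00.
apply: (@squeeze_cvge _ _ _ _ (cst 0%E) _
    (fun t => dist_L1 r (slice u t) (slice u t0))%E).
- near=> t; have tpos : 0 < t by near: t; exact: lt_nbhsr.
  rewrite integral_ge0//=.
  have [mt _ _] := lu _ tpos; have [mt0 _ _] := lu _ t00.
  have [mT _] := bounded_mfun_slice t bT; have [mT0 _] := bounded_mfun_slice t0 bT.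
  apply: le_dist_L1 => // x.
  by rewrite /slice /truncation/= tpos t00 min_max_lipschitz.
- exact: cvg_cst.
- exact: cu.
Unshelve. all: by end_near. Qed.

End L1_distance.

(** * Entropy flows *)

Section entropy_flow.
Context {R : realType}.
Implicit Types (f g w : R -> R) (u G : R * R -> R) (k m M : R).
Local Notation mu := (leb R).
Local Notation mu2 := (leb2 R).

(** Support in a compact subset of the positive half-line, as needed for the
    time factor of a test function on the half-plane. *)
Definition positive_support g : Prop :=
  exists a b : R, 0 < a /\ forall t, t < a \/ b < t -> g t = 0.

(** What the proof uses of a Kruzkov solution u of u_t + (u^m)_x = 0 with
    initial value w, for a representative bounded everywhere.  The initial
    value is attained along some filter of positive times accumulating at 0,
    since exceptional times may have to be avoided. *)
Record entropy_flow (m M : R) (w : R -> R) (u : R * R -> R) : Prop := {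
  flow_bounded : bounded_mfun u;
  flow_itv : forall z, 0 <= u z <= M;
  flow_past : forall z, z.2 <= 0 -> u z = 0;
  flow_continuous : continuous_L1loc u;
  flow_entropy : forall k f g, 0 <= k -> smooth1 f -> smooth1 g ->
    bounded_support f -> positive_support g ->
    (forall x, 0 <= f x) -> (forall t, 0 <= g t) ->
    0 <= \int[mu2]_(z in halfplane R)
      (`|u z - k| * tensor f g^`()%classic z
       + `|u z `^ m - k `^ m| * tensor f^`()%classic g z);
  flow_trace : exists F : set_system R, [/\ ProperFilter F,
    forall e, 0 < e -> \forall t \near F, 0 < t < e &
    forall r, 0 < r -> dist_L1 r (slice u t) w @[t --> F] --> 0%E] }.

Lemma positive_support_bounded g : positive_support g -> bounded_support g.
Proof.
move=> [a [b [a0 g0]]]; exists `|b| => x bx; apply: g0.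
have [x0|x0] := leP 0 x; last by left; exact: lt_trans a0.
by right; rewrite (le_lt_trans (ler_norm b))// -(ger0_norm x0).
Qed.

Lemma positive_support_le0 g t : positive_support g -> t <= 0 -> g t = 0.
Proof.
by move=> [a [b [a0 g0]]] t0; apply: g0; left; exact: le_lt_trans a0.
Qed.

Lemma derive1_positive_support g : positive_support g ->
  positive_support g^`()%classic.
Proof.
move=> [a [b [a0 g0]]]; exists a, b; split => // t tab; rewrite derive1E.
rewrite (near_eq_derive (g := cst (0 : R^o))) ?derive_cst//.
case: tab => tab.
  by near=> y; rewrite g0//; left; near: y; exact: lt_nbhsl.
by near=> y; rewrite g0//; right; near: y; exact: lt_nbhsr.
Unshelve. all: by end_near. Qed.

Lemma plateau_positive_support s t h : 0 < s -> s <= t -> 0 < h ->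
  positive_support (plateau s t h).
Proof.
move=> s0 st h0; exists s, (t + h); split => // x.
by case=> /ltW H; rewrite plateau_eq0//; [left|right].
Qed.

Lemma integral_halfplane_tensorD G1 G2 f1 f2 g1 g2 :
  bounded_mfun G1 -> bounded_mfun G2 -> tame f1 -> tame f2 ->
  tame g1 -> tame g2 -> positive_support g1 -> positive_support g2 ->
  \int[mu2]_(z in halfplane R) (G1 z * tensor f1 g1 z + G2 z * tensor f2 g2 z) =
  \int[mu]_t (slice_integral G1 f1 t * g1 t + slice_integral G2 f2 t * g2 t).
Proof.
move=> bG1 bG2 tf1 tf2 tg1 tg2 pg1 pg2.
have [i1 e1] := fubini_tensor bG1 tf1 tg1 (fun t => positive_support_le0 pg1).
have [i2 e2] := fubini_tensor bG2 tf2 tg2 (fun t => positive_support_le0 pg2).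
rewrite RintegralD ?e1 ?e2//; last exact: measurable_halfplane.
rewrite RintegralD//.
- by apply: tame_integrable; apply: tameMl => //; exact: bounded_mfun_slice_integral.
- by apply: tame_integrable; apply: tameMl => //; exact: bounded_mfun_slice_integral.
Qed.

End entropy_flow.

(** The left-hand side is 2 min(a, k). *)
Lemma norm_dist_subD_le (R : realType) (a k : R) : 0 <= a -> 0 <= k ->
  `| `|a - k| - a - k | <= 2 * k.
Proof.
move=> a0 k0; rewrite ler_norml; case: (leP a k) => H.
  by rewrite ler0_norm ?subr_le0//; lra.
by rewrite gtr0_norm ?subr_gt0//; lra.
Qed.

Lemma continuous_L1loc_lipschitz (R : realType) (u : R * R -> R) (Phi : R -> R) :
  continuous_L1loc u -> bounded_mfun u -> bounded_mfun (fun z => Phi (u z)) ->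
  (forall a b, `|Phi a - Phi b| <= `|a - b|) ->
  continuous_L1loc (fun z => Phi (u z)).
Proof.
move=> [lu cu] bu bPu Phi1; split.
  by move=> t t0; apply: bounded_locally_integrable; exact: (bounded_mfun_slice t bPu).
move=> r t0 r0 t00; apply: (@squeeze_cvge _ _ _ _ (cst 0%E) _
    (fun t => dist_L1 r (slice u t) (slice u t0))%E).
- near=> t; rewrite integral_ge0//=.
  have [mt _] := bounded_mfun_slice t bu; have [mt0 _] := bounded_mfun_slice t0 bu.
  have [mPt _] := bounded_mfun_slice t bPu; have [mPt0 _] := bounded_mfun_slice t0 bPu.
  by apply: le_dist_L1 => // x; exact: Phi1.
- exact: cvg_cst.
- exact: cu.
Unshelve. all: by end_near. Qed.

Lemma min_lipschitz (R : realType) (k a b : R) :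
  `|Num.min a k - Num.min b k| <= `|a - b|.
Proof.
have H c d : c <= d -> `|Num.min c k - Num.min d k| <= `|c - d|.
  move=> cd; rewrite distrC [leRHS]distrC !ger0_norm ?subr_ge0//; last exact: le_min2.
  by rewrite /Num.min; do 2 case: ltP => ?; lra.
by have [ab|/ltW ab] := leP a b; [exact: H|rewrite distrC [leRHS]distrC; exact: H].
Qed.

Section flow_estimates.
Context {R : realType}.
Variables (m M : R) (w : R -> R) (u : R * R -> R).
Hypotheses (m1 : 1 < m) (Hu : entropy_flow m M w u).
Hypothesis bw : bounded_mfun w.
Implicit Types (f g : R -> R) (k : R).
Local Notation mu := (leb R).

Let m_ge0 : 0 <= m. Proof. exact: ltW (lt_trans ltr01 m1). Qed.
Let bu : bounded_mfun u := flow_bounded Hu.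
Let u_ge0 z : 0 <= u z. Proof. by have /andP[] := flow_itv Hu z. Qed.
Let u_leM z : u z <= M. Proof. by have /andP[] := flow_itv Hu z. Qed.
Let M_ge0 : 0 <= M. Proof. exact: le_trans (u_ge0 (0, 0)) (u_leM (0, 0)). Qed.

Let bum : bounded_mfun (fun z => u z `^ m).
Proof. exact: bounded_mfun_powR. Qed.

Let bk k : bounded_mfun (fun z => `|u z - k|).
Proof. by apply: bounded_mfun_norm; apply: bounded_mfunB => //; exact: bounded_mfun_cst. Qed.

Let bkm k : bounded_mfun (fun z => `|u z `^ m - k `^ m|).
Proof. by apply: bounded_mfun_norm; apply: bounded_mfunB => //; exact: bounded_mfun_cst. Qed.

Let bmin k : bounded_mfun (fun z => Num.min (u z) k).
Proof. exact: bounded_mfun_min. Qed.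

Lemma flow_entropy_slices k f g : 0 <= k -> smooth1 f -> smooth1 g ->
  bounded_support f -> positive_support g ->
  (forall x, 0 <= f x) -> (forall t, 0 <= g t) ->
  0 <= \int[mu]_t (slice_integral (fun z => `|u z - k|) f t * g^`()%classic t
    + slice_integral (fun z => `|u z `^ m - k `^ m|) f^`()%classic t * g t).
Proof.
move=> k0 sf sg bf pg f0 g0; have := flow_entropy Hu k0 sf sg bf pg f0 g0.
have bg := positive_support_bounded pg.
rewrite integral_halfplane_tensorD//.
- exact: smooth1_tame.
- exact: derive1_tame.
- exact: derive1_tame.
- exact: smooth1_tame.
- exact: derive1_positive_support.
Qed.

(** The weak form of min(u, k)_t + min(u^m, k^m)_x >= 0.  At the level M, above
    all values of u, the entropy inequality reads -u_t - (u^m)_x <= 0; added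
    to the inequality at level k it turns |u - k| into k - 2 min(u, k), up to
    constants that integrate to zero against derivatives. *)
Lemma truncated_mass_weak k f g : 0 <= k -> smooth1 f -> smooth1 g ->
  bounded_support f -> positive_support g ->
  (forall x, 0 <= f x) -> (forall t, 0 <= g t) ->
  \int[mu]_t (slice_integral (fun z => Num.min (u z) k) f t * g^`()%classic t) <=
  (k `^ m * \int[mu]_x `|f^`()%classic x|) * \int[mu]_t g t.
Proof.
move=> k0 sf sg bf pg f0 g0.
have bg := positive_support_bounded pg.
have tf := smooth1_tame sf bf; have tf' := derive1_tame sf bf.
have tg := smooth1_tame sg bg; have tg' := derive1_tame sg bg.
have Ek := flow_entropy_slices k0 sf sg bf pg f0 g0.
have EM := flow_entropy_slices M_ge0 sf sg bf pg f0 g0.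
set K := \int[mu]_x `|f^`()%classic x|.
set A := slice_integral (fun z => Num.min (u z) k) f.
have bA : bounded_mfun A by exact: bounded_mfun_slice_integral.
have tE c : tame (fun t =>
    slice_integral (fun z => `|u z - c|) f t * g^`()%classic t
    + slice_integral (fun z => `|u z `^ m - c `^ m|) f^`()%classic t * g t).
  by tame_tac.
have := addr_ge0 Ek EM; rewrite -integral_tameD//.
(* the constant c disappears below, being integrated against g' *)
pose c := (k + M) * \int[mu]_x f x.
have bs t : bounded_mfun (fun x => u (x, t)) by exact: bounded_mfun_slice.
have bsm t : bounded_mfun (fun x => u (x, t) `^ m) by exact: (bounded_mfun_slice t bum).
have first_order t : slice_integral (fun z => `|u z - k|) f t +
    slice_integral (fun z => `|u z - M|) f t = c - 2 * A t.
  rewrite /c /A /slice_integral -integral_tameD; [|tame_tac..].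
  rewrite -!integral_tameZ; [|tame_tac..].
  rewrite -integral_tameB; [|tame_tac..].
  apply: eq_Rintegral => x _; rewrite mulrA -!mulrDl -mulrBl; congr (_ * _).
  have := u_leM (x, t); have := u_ge0 (x, t); move: (u (x, t)) => a a0 aM.
  rewrite (ler0_norm (x := a - M)) ?subr_le0// /Num.min.
  case: ltP => ak; first by rewrite ltr0_norm ?subr_lt0//; ring.
  by rewrite ger0_norm ?subr_ge0//; ring.
have flux t : slice_integral (fun z => `|u z `^ m - k `^ m|) f^`()%classic t +
    slice_integral (fun z => `|u z `^ m - M `^ m|) f^`()%classic t <= 2 * (k `^ m * K).
  rewrite /slice_integral -integral_tameD; [|tame_tac..].
  have -> : 2 * (k `^ m * K) = (k `^ m + M `^ m) * \int[mu]_x f^`()%classic x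
      + 2 * k `^ m * K.
    by rewrite integral_derive1_eq0// mulr0 add0r mulrA.
  rewrite /K -!integral_tameZ; [|tame_tac..].
  rewrite -integral_tameD; [|tame_tac..].
  apply: le_integral_tame; [tame_tac..|].
  move=> x; have := u_leM (x, t); have := u_ge0 (x, t).
  move: (u (x, t)) => a a0 aM.
  have am : a `^ m <= M `^ m by apply: ge0_ler_powR; rewrite ?nnegrE.
  rewrite -mulrDl (ler0_norm (x := a `^ m - M `^ m)) ?subr_le0//.
  have a0' := powR_ge0 a m; have k0' := powR_ge0 k m.
  move: (a `^ m) (k `^ m) (M `^ m) (f^`()%classic x) am a0' k0' => a' k' M' d aM' a0' k0'.
  have -> : (`|a' - k'| + - (a' - M')) * d = (k' + M') * d + (`|a' - k'| - a' - k') * d by ring.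
  rewrite lerD2l; set q := `|a' - k'| - a' - k'.
  apply: le_trans (ler_norm _) _; rewrite normrM ler_wpM2r// /q.
  exact: norm_dist_subD_le.
move=> H.
have {}H : 0 <= \int[mu]_t (c * g^`()%classic t - 2 * (A t * g^`()%classic t)
    + 2 * (k `^ m * K) * g t).
  apply: (le_trans H); apply: le_integral_tame; [tame_tac|tame_tac|].
  move=> t; rewrite addrACA -!mulrDl first_order mulrBl -!mulrA lerD2l.
  by rewrite !mulrA ler_wpM2r// -mulrA flux.
move: H; rewrite integral_tameD; [|tame_tac..].
rewrite integral_tameB; [|tame_tac..].
rewrite !integral_tameZ; [|tame_tac..].
rewrite integral_derive1_eq0// mulr0 sub0r.
rewrite addrC subr_ge0 -mulrA ler_pM2l ?ltr0n//.
Qed.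


(** The initial value is a limit in L^1_loc, and the non-expansive map Phi
    preserves this convergence. *)
Lemma initial_integral_le (Phi : R -> R) f (c t : R) : 0 < t ->
  measurable_fun setT Phi -> (forall a b, `|Phi a - Phi b| <= `|a - b|) ->
  bounded_mfun (fun z => Phi (u z)) -> bounded_mfun (fun x => Phi (w x)) ->
  tame f ->
  (forall s, 0 < s < t -> slice_integral (fun z => Phi (u z)) f s <= c) ->
  \int[mu]_x (Phi (w x) * f x) <= c.
Proof.
move=> t0 mPhi Phi1 bPu bPw tf H; have [F [PF F0 Fw]] := flow_trace Hu.
have cv : slice_integral (fun z => Phi (u z)) f s @[s --> F] -->
    \int[mu]_x (Phi (w x) * f x).
  apply: (@L1loc_cvg_integral _ _ F _ (fun s x => Phi (u (x, s)))) => //.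
    by apply: nearW => s; exact: (bounded_mfun_slice s bPu).
  move=> r r0; apply: (@squeeze_cvge _ _ _ _ (cst 0%E) _
    (fun s => dist_L1 r (slice u s) w)%E).
  - apply: nearW => s; rewrite integral_ge0//=.
    have [mus _] := bounded_mfun_slice s bu; have [mw _] := bw.
    apply: le_dist_L1.
    + exact: (measurableT_comp mPhi mus).
    + exact: (measurableT_comp mPhi mw).
    + exact: mus.
    + exact: mw.
    + by move=> x; exact: Phi1.
  - exact: cvg_cst.
  - exact: Fw.
rewrite -(cvg_lim _ cv)//; apply: limr_le; first by apply/cvg_ex; eexists; exact: cv.
by near=> s; apply: H; near: s; exact: F0.
Unshelve. all: by end_near. Qed.

(** Mass below level k is lost at most at the rate of the truncated flux,
    which is bounded by k^m. *)
Lemma truncated_mass_ge k f (t : R) : 0 <= k -> smooth1 f -> bounded_support f ->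
  (forall x, 0 <= f x) -> 0 < t ->
  \int[mu]_x (Num.min (w x) k * f x) <=
  slice_integral (fun z => Num.min (u z) k) f t
    + (k `^ m * \int[mu]_x `|f^`()%classic x|) * t.
Proof.
move=> k0 sf bf f0 t0; have tf := smooth1_tame sf bf.
set C := k `^ m * _.
have C0 : 0 <= C by rewrite mulr_ge0 ?powR_ge0//; apply: Rintegral_ge0.
have bminw : bounded_mfun (fun x => Num.min (w x) k) by exact: bounded_mfun_min.
apply: (@initial_integral_le (fun a => Num.min a k) _ _ t) => //.
- exact: measurable_minr.
- by move=> a b; exact: min_lipschitz.
move=> s /andP[s0 st].
rewrite -lerBlDl.
apply: (le_trans (y := C * (t - s))); last by rewrite ler_wpM2l// gerBl ltW.
apply: (@plateau_increment _ (slice_integral (fun z => Num.min (u z) k) f) 0) => //.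
- by apply: bounded_mfun_slice_integral.
- move=> t2 t20; apply: continuous_slice_integral => //.
  apply: (@continuous_L1loc_lipschitz _ u (fun a => Num.min a k)) => //.
    exact: flow_continuous Hu.
  by move=> a b; exact: min_lipschitz.
- move=> s1 t2 h s10 st2 hpos; apply: truncated_mass_weak => //.
  + exact: plateau_smooth.
  + by apply: plateau_positive_support => //; exact: ltW.
  + by move=> x; apply: plateau_ge0 => //; exact: ltW.
- exact: ltW.
Qed.

End flow_estimates.

(** * No mass is created *)

Section mass_bound.
Context {R : realType}.
Variables (m M : R) (w : R -> R) (u : R * R -> R).
Hypotheses (m1 : 1 < m) (Hu : entropy_flow m M w u).
Hypotheses (bw : bounded_mfun w) (w01 : forall x, 0 <= w x <= 1).
Hypothesis (w_int : (leb R).-integrable setT (EFin \o w)).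
Implicit Types (f g : R -> R) (k n c l t : R).
Local Notation mu := (leb R).

Let m_ge0 : 0 <= m. Proof. exact: ltW (lt_trans ltr01 m1). Qed.
Let bu : bounded_mfun u := flow_bounded Hu.
Let u_ge0 z : 0 <= u z. Proof. by have /andP[] := flow_itv Hu z. Qed.
Let u_leM z : u z <= M. Proof. by have /andP[] := flow_itv Hu z. Qed.
Let M_ge0 : 0 <= M. Proof. exact: le_trans (u_ge0 (0, 0)) (u_leM (0, 0)). Qed.
Let bum : bounded_mfun (fun z => u z `^ m).
Proof. exact: bounded_mfun_powR. Qed.

Let L := M `^ (m - 1).

Let flux_le z : u z `^ m <= L * u z.
Proof.
rewrite -(mulr_powRB1 (u_ge0 z) (lt_trans ltr01 m1)) mulrC ler_wpM2r//.
by apply: ge0_ler_powR; rewrite ?nnegrE// subr_ge0 ltW.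
Qed.

Lemma initial_integral_ge f (c t : R) : 0 < t -> tame f ->
  (forall s, 0 < s < t -> c <= slice_integral u f s) ->
  c <= \int[mu]_x (w x * f x).
Proof.
move=> t0 tf H; rewrite -lerN2 -mulN1r -integral_tameZ; last by tame_tac.
under eq_Rintegral do rewrite mulrCA.
apply: (initial_integral_le Hu bw (Phi := id) t0) => //.
  exact: tameZ.
move=> s st; rewrite /slice_integral.
have bs : bounded_mfun (fun x => u (x, s)) by exact: bounded_mfun_slice.
under eq_Rintegral do rewrite mulrCA.
by rewrite integral_tameZ ?mulN1r ?lerN2; [exact: H|tame_tac].
Qed.

(** An exponential weight, cut off smoothly near -n and near c.  The
    exponential absorbs the flux, which is at most L u on the range of u, by
    Gronwall, and makes the cut-off error at -n negligible. *)
Definition exp_weight l n c x : R := expR (l * x) * plateau (- n) c 1 x.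

Let smooth1_expl l : smooth1 (fun x => expR (l * x)).
Proof.
rewrite (_ : (fun _ => _) = fun x => expR (l * x + 0)).
  exact/smooth1_affine/smooth1_expR.
by apply/funext => x; rewrite addr0.
Qed.

Let derive_expl l (x : R) : is_derive x 1 (fun x => expR (l * x)) (l * expR (l * x)).
Proof.
rewrite mulrC; apply: (is_derive1_comp (f := expR) (g := fun x => l * x)).
have := is_deriveZ l (is_derive_id x (1 : R)).
by rewrite /GRing.scale /= mulr1.
Qed.

Lemma exp_weight_smooth l n c : smooth1 (exp_weight l n c).
Proof. by apply: smooth1M; [exact: smooth1_expl|exact: plateau_smooth]. Qed.

Lemma exp_weight_bounded_support l n c : - n <= c ->
  bounded_support (exp_weight l n c).
Proof.
move=> nc; have [r Hr] := plateau_bounded_support ltr01 nc.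
by exists r => x /Hr; rewrite /exp_weight => ->; rewrite mulr0.
Qed.

Lemma exp_weight_ge0 l n c x : - n <= c -> 0 <= exp_weight l n c x.
Proof. by move=> nc; rewrite mulr_ge0 ?expR_ge0// plateau_ge0. Qed.

(** Only the cut-off at -n contributes, apart from the exponential: at c the
    weight decreases, which has the good sign because the flux is
    nonnegative. *)
Lemma derive1_exp_weight_le l n c x : 0 <= l -> - n <= c ->
  (exp_weight l n c)^`()%classic x <= l * exp_weight l n c x
    + expR (l * (1 - n)) * (ramp (- n) 1)^`()%classic x.
Proof.
move=> l0 nc; have -> : (exp_weight l n c)^`()%classic x =
    expR (l * x) * ((ramp (- n) 1)^`()%classic x - (ramp c 1)^`()%classic x)
    + plateau (- n) c 1 x * (l * expR (l * x)).
  have sp : is_derive x (1 : R) (plateau (- n) c 1) ((plateau (- n) c 1)^`()%classic x).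
    by apply: smooth1_is_derive; exact: plateau_smooth.
  rewrite derive1_plateau in sp.
  have [_ E] := is_deriveM (derive_expl l x) sp.
  by rewrite derive1E; exact: E.
rewrite addrC; apply: lerD.
  by rewrite /exp_weight mulrCA [_ * plateau _ _ _ _]mulrC mulrCA.
have r1 := ramp_derive_ge0 (- n) x (@ltr01 R).
have r2 := ramp_derive_ge0 c x (@ltr01 R).
apply: (@le_trans _ _ (expR (l * x) * (ramp (- n) 1)^`()%classic x)).
  by apply: ler_wpM2l; [exact: expR_ge0|rewrite gerBl; exact: r2].
have [xn|xn] := leP x (- n + 1); last first.
  by rewrite ramp_derive_eq0 ?mulr0//; right.
apply: ler_wpM2r; first exact: r1.
by rewrite ler_expR; apply: ler_wpM2l; [exact: l0|rewrite addrC].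
Qed.

(** Gronwall: the factor exp(-l L t) compensates the growth of the weighted
    mass, so that the product increases at most by the cut-off error. *)
Lemma exp_weighted_mass_le l n c t : 0 < l -> - n <= c -> 0 < t ->
  expR (- (l * L) * t) * slice_integral u (exp_weight l n c) t <=
  \int[mu]_x (w x * exp_weight l n c x) + M `^ m * expR (l * (1 - n)) * t.
Proof.
move=> l0 nc t0; set f := exp_weight l n c; set d := M `^ m * _.
pose e s := expR (- (l * L) * s).
have L0 : 0 <= L by exact: powR_ge0.
have lL0 : 0 <= l * L by rewrite mulr_ge0// ltW.
have d0 : 0 <= d by rewrite mulr_ge0 ?powR_ge0 ?expR_ge0.
have sf : smooth1 f by exact: exp_weight_smooth.
have bf : bounded_support f by exact: exp_weight_bounded_support.
have tf := smooth1_tame sf bf; have tf' := derive1_tame sf bf.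
have f0 x : 0 <= f x by exact: exp_weight_ge0.
have e_le1 s : 0 <= s -> e s <= 1.
  by move=> s0; rewrite -expR0 ler_expR mulNr oppr_le0 mulr_ge0.
pose I := slice_integral u f; pose B s := e s * I s.
have bI : bounded_mfun I by exact: bounded_mfun_slice_integral.
(* before time 0 the exponential is large, but u vanishes there *)
have bB : bounded_mfun B.
  case: bI => mI [C hC]; split.
    apply: measurable_funM => //; apply: continuous_measurable_fun.
    exact/smooth1_continuous/smooth1_expl.
  exists C => s; have [s0|/ltW s0] := leP s 0.
    rewrite /B /I /slice_integral; under eq_Rintegral do rewrite (flow_past Hu)// mul0r.
    by rewrite /Rintegral integral0 mulr0 normr0 (le_trans _ (hC 0)).
  rewrite /B normrM (ger0_norm (expR_ge0 _)); apply: le_trans (hC s).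
  by rewrite ler_piMl// e_le1.
have cB s : 0 < s -> {for s, continuous B}.
  move=> s0; apply: cvgM; first exact/smooth1_continuous/smooth1_expl.
  exact: (continuous_slice_integral bu tf (flow_continuous Hu)).
have tr : tame (ramp (- n) 1)^`()%classic by exact: ramp_derive_tame.
have bs s : bounded_mfun (fun x => u (x, s)) by exact: bounded_mfun_slice.
have bsm s : bounded_mfun (fun x => u (x, s) `^ m) by exact: (bounded_mfun_slice s bum).
have flux s : slice_integral (fun z => `|u z `^ m - 0 `^ m|) f^`()%classic s <=
    l * L * I s + d.
  have -> : l * L * I s + d = l * L * I s +
      d * \int[mu]_x (ramp (- n) 1)^`()%classic x.
    by rewrite integral_ramp_derive// mulr1.
  rewrite /I /slice_integral -!integral_tameZ; [|tame_tac..].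
  rewrite -integral_tameD; [|tame_tac..].
  apply: le_integral_tame; [tame_tac..|] => x.
  rewrite powR0 ?gt_eqF ?(lt_trans ltr01 m1)// subr0 ger0_norm ?powR_ge0//.
  have um0 := powR_ge0 (u (x, s)) m.
  apply: (le_trans (ler_wpM2l um0 (derive1_exp_weight_le x (ltW l0) nc))).
  rewrite mulrDr; apply: lerD.
    rewrite mulrCA -[leRHS]mulrA ler_wpM2l ?(ltW l0)// mulrA ler_wpM2r//.
  rewrite mulrA ler_wpM2r ?ramp_derive_ge0// ler_wpM2r ?expR_ge0//.
  by apply: ge0_ler_powR; rewrite ?nnegrE.
have weak s1 s2 h : 0 < s1 -> s1 < s2 -> 0 < h ->
    \int[mu]_x (-1 * B x * (plateau s1 s2 h)^`()%classic x) <=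
    d * \int[mu]_x plateau s1 s2 h x.
  move=> s10 s12 h0; set th := plateau s1 s2 h.
  have sth : smooth1 th by exact: plateau_smooth.
  have th0 x : 0 <= th x by apply: plateau_ge0 => //; exact: ltW.
  have pth : positive_support th by apply: plateau_positive_support => //; exact: ltW.
  have bth := positive_support_bounded pth.
  have tth := smooth1_tame sth bth; have tth' := derive1_tame sth bth.
  pose g x := e x * th x.
  have sg : smooth1 g by apply: smooth1M; [exact: smooth1_expl|exact: sth].
  have pg : positive_support g.
    by have [a [b [a0 H]]] := pth; exists a, b; split => // x /H; rewrite /g => ->; rewrite mulr0.
  have bg := positive_support_bounded pg.
  have tg := smooth1_tame sg bg; have tg' := derive1_tame sg bg.
  have g0 x : 0 <= g x by rewrite mulr_ge0 ?expR_ge0.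
  have g'E x : g^`()%classic x = e x * th^`()%classic x - l * L * g x.
    have [_ E] := is_deriveM (derive_expl (- (l * L)) x) (smooth1_is_derive x sth).
    rewrite derive1E; apply: (eq_trans E); rewrite /GRing.scale /= /g /e; ring.
  have bk0 : bounded_mfun (fun z => `|u z - 0|).
    by apply: bounded_mfun_norm; apply: bounded_mfunB => //; exact: bounded_mfun_cst.
  have bkm0 : bounded_mfun (fun z => `|u z `^ m - 0 `^ m|).
    by apply: bounded_mfun_norm; apply: bounded_mfunB => //; exact: bounded_mfun_cst.
  have := flow_entropy_slices m1 Hu (lexx 0) sf sg bf pg f0 g0.
  have -> : slice_integral (fun z => `|u z - 0|) f = I.
    apply/funext => s; apply: eq_Rintegral => x _.
    by rewrite subr0 ger0_norm.
  move=> H.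
  have {}H : 0 <= \int[mu]_t (B t * th^`()%classic t + d * th t).
    apply: (le_trans H); apply: le_integral_tame; [tame_tac..|] => s.
    apply: (@le_trans _ _ (I s * g^`()%classic s + (l * L * I s + d) * g s)).
      by rewrite lerD2l ler_wpM2r.
    rewrite g'E.
    have -> : I s * (e s * th^`()%classic s - l * L * g s) + (l * L * I s + d) * g s
       = B s * th^`()%classic s + d * g s by rewrite /B; ring.
    rewrite lerD2l ler_wpM2l// /g.
    have [s0|/ltW s0] := leP s 0; first by rewrite (positive_support_le0 pth)// mulr0.
    by rewrite ler_piMl// e_le1.
  move: H; rewrite integral_tameD; [|tame_tac..].
  rewrite integral_tameZ; last exact: tth.
  have -> : \int[mu]_x (-1 * B x * th^`()%classic x) =
      - \int[mu]_x (B x * th^`()%classic x).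
    rewrite -[RHS]mulN1r -[RHS]integral_tameZ; last by tame_tac.
    by apply: eq_Rintegral => x _; rewrite mulrA.
  by move=> H; rewrite -subr_ge0 opprK addrC.
rewrite -lerBlDr; apply: (initial_integral_ge t0 tf) => s /andP[s0 st].
have bNB : bounded_mfun (fun s => -1 * B s) by exact: bounded_mfunZ.
have cNB s' : 0 < s' -> {for s', continuous (fun s => -1 * B s)}.
  by move=> s'0; apply: cvgM; [exact: cvg_cst|exact: cB].
have := plateau_increment bNB d0 cNB weak s0 (ltW st).
rewrite !mulN1r opprK addrC lerBlDr -/(e t) -/(I t) -/(B t) => H.
rewrite lerBlDr; apply: (le_trans H).
rewrite addrC lerD//; last by rewrite ler_wpM2l// gerBl ltW.
rewrite /B ler_piMl ?e_le1 ?(ltW s0)//.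
by apply: Rintegral_ge0 => x _; rewrite mulr_ge0.
Qed.

(** The cut-off is first moved to minus infinity, which removes the error term;
    then the exponential weight is flattened by letting l tend to 0. *)
Lemma mass_le f t : tame f -> (forall x, 0 <= f x <= 1) -> 0 < t ->
  slice_integral u f t <= \int[mu]_x w x.
Proof.
move=> tf f01 t0; have [_ [r' fr']] := tf.
pose r := `|r'|; have r0 : 0 <= r by exact: normr_ge0.
have fr x : r < `|x| -> f x = 0.
  by move=> rx; apply: fr'; rewrite (le_lt_trans (ler_norm _)).
have bs s : bounded_mfun (fun x => u (x, s)) by exact: bounded_mfun_slice.
have L0 : 0 <= L by exact: powR_ge0.
have W0 : 0 <= \int[mu]_x w x.
  by apply: Rintegral_ge0 => x _; have /andP[] := w01 x.
have S0 : 0 <= slice_integral u f t.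
  by apply: Rintegral_ge0 => x _; rewrite mulr_ge0//; have /andP[] := f01 x.
have step l n : 0 < l -> r + 1 <= n ->
    expR (- (l * (L * t + r))) * slice_integral u f t <=
    expR (l * (r + 1)) * \int[mu]_x w x + M `^ m * expR (l * (1 - n)) * t.
  move=> l0 rn; have nr : - n <= r by lra.
  have tF : tame (exp_weight l n r).
    by apply: smooth1_tame; [exact: exp_weight_smooth|exact: exp_weight_bounded_support].
  have := exp_weighted_mass_le l0 nr t0; set F := exp_weight l n r => H.
  apply: le_trans (le_trans H _); last first.
    rewrite lerD2r /Rintegral -/(Rintegral mu setT _) -/(Rintegral mu setT w).
    rewrite -RintegralZl//; apply: le_Rintegral => //.
    - by apply: tame_integrable; tame_tac.
    - by have := integrableZl measurableT (expR (l * (r + 1))) w_int; apply: eq_integrable.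
    - move=> x _; have /andP[w0 w1] := w01 x; rewrite mulrC ler_wpM2r// /F /exp_weight.
      have [xr|xr] := leP x (r + 1); last by rewrite plateau_eq0 ?mulr0 ?expR_ge0//; right; exact: ltW.
      rewrite -[leRHS]mulr1; apply: ler_pM; rewrite ?expR_ge0 ?plateau_ge0 ?plateau_le1//.
      by rewrite ler_expR ler_wpM2l// ltW.
  rewrite mulrDr opprD expRD mulrA -mulNr -!mulrA ler_wpM2l ?expR_ge0//.
  rewrite /slice_integral -integral_tameZ; last by tame_tac.
  apply: le_integral_tame; [tame_tac..|] => x.
  rewrite mulrCA ler_wpM2l// /F /exp_weight.
  have [rx|xr] := ltP r `|x|; first by rewrite fr// mulr0 mulr_ge0 ?expR_ge0 ?plateau_ge0.
  move: xr; rewrite ler_norml => /andP[rx xr].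
  have -> : plateau (- n) r 1 x = 1.
    by rewrite /plateau ramp_eq1 ?ramp_eq0 ?subr0//; lra.
  have /andP[fx0 fx1] := f01 x.
  by apply: ler_pM; rewrite ?expR_ge0// ler_expR -mulrN ler_wpM2l// ltW.
pose a := L * t + r; pose b := r + 1.
have tail_free l : 0 < l -> expR (- (l * a)) * slice_integral u f t <=
    expR (l * b) * \int[mu]_x w x.
  move=> l0; apply/ler_addgt0Pr => eps eps0.
  have Q0 : 0 < M `^ m * t + 1 by rewrite ltr_wpDl// mulr_ge0 ?powR_ge0// ltW.
  near +oo_R => y.
  have yr : l * r <= y by near: y; apply: nbhs_pinfty_ge; exact: num_real.
  have yE : expR (- y) <= eps / (M `^ m * t + 1).
    near: y; have /cvgrPdist_le := @cvgr_expR R => /(_ _ (divr_gt0 eps0 Q0)).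
    by apply: filterS => y; rewrite sub0r normrN ger0_norm ?expR_ge0.
  (* n = 1 + y / l makes the error factor equal to exp(-y) *)
  have rn : r + 1 <= 1 + y / l.
    by rewrite [leLHS]addrC lerD2l ler_pdivlMr// mulrC.
  have H := step l (1 + y / l) l0 rn.
  apply: (le_trans H); rewrite lerD2l.
  have -> : l * (1 - (1 + y / l)) = - y.
    by rewrite opprD addNKr mulrN mulrCA divff ?mulr1// gt_eqF.
  rewrite mulrAC; apply: (@le_trans _ _ ((M `^ m * t + 1) * expR (- y))).
    by rewrite ler_wpM2r ?expR_ge0// lerDl.
  by rewrite -ler_pdivlMl// mulrC.
have bound l : 0 < l -> slice_integral u f t <= expR (l * (a + b)) * \int[mu]_x w x.
  move=> l0; rewrite mulrDr expRD -mulrA -ler_pdivrMl ?expR_gt0// -expRN.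
  exact: tail_free.
have cv : (fun l : R => expR (l * (a + b)) * \int[mu]_x w x) l @[l --> 0^'+]
    --> \int[mu]_x w x.
  rewrite -[X in _ --> X]mul1r -expR0.
  apply: cvg_at_right_filter; apply: cvgM; last exact: cvg_cst.
  have sE : smooth1 (fun x => expR ((a + b) * x)) by exact: smooth1_expl.
  have := @smooth1_continuous _ _ sE 0.
  rewrite /continuous_at mulr0; under eq_fun do rewrite mulrC.
  exact.
rewrite -[leRHS](cvg_lim _ cv)//; apply: limr_ge; first by apply/cvg_ex; eexists; exact: cv.
by near=> l; apply: bound; near: l; exact: nbhs_right_gt.
Unshelve. all: by end_near. Qed.

End mass_bound.

(** * Smooth step approximation *)

Lemma dist_clamp_le (R : realType) (d a b : R) : 0 <= a -> a <= 1 ->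
  0 < d -> d <= 1 ->
  `|a - Num.min (Num.max b 0) (1 - d)| <= `|a - b| + d.
Proof.
move=> a0 a1 d0 d1; rewrite ler_norml.
have := ler_norm (a - b); have := ler_norm (b - a); rewrite distrC.
rewrite /Num.max; case: ltP => ?; rewrite /Num.min; case: ltP => ? ? ?; lra.
Qed.


Section step_approximation.
Context {R : realType}.
Implicit Types (w c f : R -> R) (a b d e r : R).
Local Notation mu := (leb R).

Lemma tame_sum (F : nat -> R -> R) (N : nat) : (forall i, tame (F i)) ->
  tame (fun x => \sum_(0 <= i < N) F i x) /\
  \int[mu]_x (\sum_(0 <= i < N) F i x) = \sum_(0 <= i < N) \int[mu]_x F i x.
Proof.
move=> tF; elim: N => [|N [tN IH]].
  under [X in tame X]eq_fun do rewrite big_nil.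
  under eq_Rintegral do rewrite big_nil.
  rewrite big_nil /Rintegral integral0; split => //.
  by split; [exact: bounded_mfun_cst|exists 0].
have E x : \sum_(0 <= i < N.+1) F i x = \sum_(0 <= i < N) F i x + F N x.
  by rewrite big_nat_recr.
have tFN := tF N; split.
  by rewrite (_ : (fun x => _) = fun x => \sum_(0 <= i < N) F i x + F N x);
    [tame_tac|exact/funext].
under eq_Rintegral do rewrite E.
by rewrite integral_tameD// IH [RHS]big_nat_recr.
Qed.

(** Heine-Cantor, with one of the two points allowed to leave the segment. *)
Lemma uniformly_continuous_segment c a b e : continuous c -> 0 < e ->
  \forall d \near 0^'+, forall x y, a <= x <= b -> `|x - y| <= d ->
    `|c x - c y| <= e.
Proof.
move=> cc e0.
have : \forall d \near (0 : R)^'+, `[a, b]%classic `<=`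
    (fun x => forall y, `|x - y| <= d -> `|c x - c y| <= e).
  have /compact_near_coveringP := @segment_compact R a b.
  apply => x _.
  have e2 : 0 < e / 2 by rewrite divr_gt0.
  have /cvgrPdist_le/(_ _ e2)/nbhs_ballP[d /= d0 Hd] := cc x.
  exists (ball x (d / 2), [set s | 0 < s < d / 2]).
    split; first by apply: nbhsx_ballx; rewrite divr_gt0.
    near=> s => /=; apply/andP; split; near: s; first exact: nbhs_right_gt.
    by apply: nbhs_right_lt; rewrite divr_gt0.
  move=> [x' s] [/= xx' /andP[s0 sd]] y x'y.
  rewrite /ball/= in xx'.
  have H1 : `|c x - c x'| <= e / 2.
    by apply: Hd; rewrite /ball/=; apply: (lt_trans xx'); rewrite gtr_pMr// invf_lt1// ltr1n.
  have H2 : `|c x - c y| <= e / 2.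
    apply: Hd; rewrite /ball/= -(subrK x' x) -addrA.
    apply: le_lt_trans (ler_normD _ _) _; rewrite [d]splitr.
    by apply: ltr_leD => //; exact: le_trans (ltW sd).
  rewrite [e]splitr -(subrK (c x) (c x')) -addrA.
  by apply: le_trans (ler_normD _ _) _; rewrite lerD// distrC.
by apply: filterS => d Hd x y xab; apply: Hd; rewrite /= in_itv.
Unshelve. all: by end_near. Qed.

Lemma integral_segment f r : tame (fun x => f x * box r x) ->
  (\int[mu]_(x in (`[(- r)%R, r]%classic : set R)) (f x)%:E)%E =
    (\int[mu]_x (f x * box r x))%:E.
Proof.
move=> tf; rewrite /Rintegral fineK; last exact/integrable_fin_num/tame_integrable.
rewrite [LHS]integral_mkcond; apply: eq_integral => x _.
rewrite patchE /box indicE; case: ifPn => H; first by rewrite mulr1.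
by rewrite mulr0.
Qed.

Lemma continuous_box_tame c r : continuous c -> tame (fun x => c x * box r x).
Proof.
move=> cc; split; last by exists r => x rx; rewrite boxE leNgt rx mulr0.
split.
  apply: measurable_funM; first exact: continuous_measurable_fun.
  by case: (box_tame r) => -[].
have cK : compact [set c x | x in `[- r, r]%classic].
  apply: continuous_compact; last exact: segment_compact.
  exact: continuous_subspaceT.
have [M [Mr hM]] := compact_bounded cK.
exists (`|M| + 1) => x; rewrite boxE; case: (leP `|x| r) => xr /=; last first.
  by rewrite mulr0 normr0 addr_ge0.
rewrite mulr1; apply: hM; first by rewrite ltr_pwDr// ler_norm.
by exists x => //; rewrite /= in_itv/= -ler_norml.
Qed.

Lemma integral_box_cvg w e : (forall x, 0 <= w x) ->
  mu.-integrable setT (EFin \o w) -> bounded_mfun w -> 0 < e -> forall r,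
  exists2 s, r <= s & \int[mu]_x w x <= \int[mu]_x (w x * box s x) + e.
Proof.
move=> w0 iw bw e0 r; pose seg (s : R) : set R := `[- s, s]%classic.
have bE (s : R) : (\int[mu]_(x in seg s) (w x)%:E)%E =
    (\int[mu]_x (w x * box s x))%:E.
  by apply: integral_segment; tame_tac.
have U : \bigcup_n seg n%:R = [set: R].
  apply/seteqP; split => // x _; exists (Num.truncn `|x|).+1 => //.
  by rewrite /seg /= in_itv/= -ler_norml ltW// truncnS_gt.
have cv : (\int[mu]_(x in seg n%:R%R) (w x)%:E)%E @[n --> \oo] -->
    (\int[mu]_x (w x)%:E)%E.
  rewrite -[X in _ --> integral _ X _]U.
  apply: ge0_nondecreasing_set_cvg_integral.
  - move=> n p np; apply/subsetPset => x; rewrite /seg /= !in_itv/= -!ler_norml => xn.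
    by rewrite (le_trans xn)// ler_nat.
  - by move=> n; rewrite /seg.
  - by move=> n; apply/measurable_EFinP/measurable_funTS; case: bw.
  - by move=> n x _; rewrite lee_fin.
move: cv; under eq_fun do rewrite bE; move=> cv.
rewrite -[X in _ --> X]fineK in cv; last exact: integrable_fin_num.
move/fine_cvg : cv => /cvgrPdist_le/(_ _ e0) cv.
near \oo => n; exists n%:R; first by near: n; exact: nbhs_infty_ger.
rewrite -lerBlDl; apply: le_trans (ler_norm _) _.
by near: n; exact: cv.
Unshelve. all: by end_near. Qed.

(** Truncating the approximation at 1 - d costs at most d and keeps its values
    away from 1, which is what makes their m-th powers vanish. *)
Lemma continuous_box_approx w e r : bounded_mfun w -> (forall x, 0 <= w x <= 1) ->
  0 < e -> exists c k, [/\ continuous c, forall x, 0 <= c x <= k, k < 1 &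
    \int[mu]_x (`|w x - c x| * box r x) <= e].
Proof.
move=> bw w01 e0.
pose seg : set R := `[- r, r]%classic.
have mE : measurable seg by rewrite /seg.
have muE : (mu seg < +oo)%E.
  by rewrite /leb /seg /= lebesgue_measure_itv/=; case: ifP => // _; rewrite -EFinB ltry.
have iw : mu.-integrable seg (EFin \o w).
  apply: (measurable_bounded_integrable (mu := mu) mE muE).
    by apply: measurable_funTS; case: bw.
  exists 1; split => // y y1 x _; have /andP[wx0 wx1] := w01 x.
  by rewrite /= ger0_norm// (le_trans wx1)// ltW.
have [g [cg ig gcv]] := approximation_continuous_integrable mE muE iw.
have e2 : 0 < e / 2 by rewrite divr_gt0.
pose S := \int[mu]_x box r x.
have S0 : 0 <= S by apply: Rintegral_ge0 => x _; exact: box_ge0.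
have S1 : 0 < S + 1 by rewrite ltr_wpDl.
pose d := Num.min (e / 2 / (S + 1)) 1.
have d0 : 0 < d by rewrite lt_min ltr01 andbT divr_gt0.
have d1 : d <= 1 by rewrite ge_min lexx orbT.
have [n Hn] : exists n, (\int[mu]_(x in seg) `|(w x - g n x)%:E| <= (e / 2)%:E)%E.
  move/fine_cvgP : gcv => [fn /cvgrPdist_le/(_ _ e2) cvn].
  near \oo => n; exists n.
  have fnn : (\int[mu]_(x in seg) `|(w x - g n x)%:E|)%E \is a fin_num.
    by near: n; exact: fn.
  rewrite -(fineK fnn) lee_fin; apply: le_trans (ler_norm _) _.
  by rewrite -normrN -sub0r; near: n; exact: cvn.
have tg : tame (fun x => `|w x - g n x| * box r x).
  rewrite (_ : (fun x => _) = fun x => `|w x * box r x - g n x * box r x|).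
    have tg := continuous_box_tame r (cg n).
    by apply: tame_norm; apply: tameB => //; apply: tameMl => //; exact: box_tame.
  by apply/funext => x; rewrite -mulrBl normrM (ger0_norm (box_ge0 r x)).
have tb := box_tame r.
rewrite (integral_segment tg) lee_fin in Hn.
pose c x := Num.min (Num.max (g n x) 0) (1 - d).
have cc : continuous c.
  move=> x; apply: (@continuous_min _ _ (fun x => Num.max (g n x) 0) (cst (1 - d))).
    apply: (@continuous_max _ _ (g n) (cst 0)); first exact: cg.
    exact: cvg_cst.
  exact: cvg_cst.
have c01 x : 0 <= c x <= 1 - d.
  by rewrite le_min le_max lexx orbT subr_ge0 d1 ge_min lexx orbT.
have bc : bounded_mfun c.
  split; first exact: continuous_measurable_fun.
  by exists (1 - d) => x; have /andP[c0 c1] := c01 x; rewrite ger0_norm.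
exists c, (1 - d); split => //; first by rewrite gtrBl.
apply: (@le_trans _ _ (\int[mu]_x (`|w x - g n x| * box r x + d * box r x))).
  apply: le_integral_tame; [tame_tac|tame_tac|] => x.
  rewrite -mulrDl ler_wpM2r ?box_ge0// /c.
  have /andP[w0 w1] := w01 x; move: (w x) (g n x) w0 w1 => a b a0 a1.
  by move: d0 d1; clear -a0 a1; exact: dist_clamp_le.
rewrite integral_tameD; [|tame_tac..]; rewrite integral_tameZ//.
rewrite [e]splitr lerD// -/S.
apply: (@le_trans _ _ (e / 2 / (S + 1) * S)).
  by rewrite ler_wpM2r// /d ge_min lexx.
rewrite -mulrA ler_piMr ?(ltW e2)// mulrC ler_pdivrMr// mul1r lerDl//.
Unshelve. all: by end_near. Qed.

(** Consecutive plateaus telescope: they form a partition of unity. *)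
Lemma sum_plateau (x0 h : R) (N : nat) x :
  \sum_(0 <= i < N) plateau (x0 + i%:R * h) (x0 + i.+1%:R * h) h x =
  plateau x0 (x0 + N%:R * h) h x.
Proof.
under eq_bigr do rewrite /plateau -opprB.
rewrite sumrN (telescope_sumr (fun i => ramp (x0 + i%:R * h) h x))//.
by rewrite opprB mul0r addr0.
Qed.

(** The constants stay strictly below 1 so that their m-th powers vanish in the
    limit, and the cells cover a given ball and most of the mass of w. *)
Lemma smooth_step_approximation w e r : bounded_mfun w ->
  (forall x, 0 <= w x <= 1) -> mu.-integrable setT (EFin \o w) -> 0 < e ->
  exists (N : nat) (phi : nat -> R -> R) (k : nat -> R), [/\
    forall i, [/\ smooth1 (phi i), bounded_support (phi i) &
      forall x, 0 <= phi i x],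
    forall i, 0 <= k i < 1,
    forall x, box r x <= \sum_(0 <= i < N) phi i x <= 1,
    \int[mu]_x w x <= \sum_(0 <= i < N) \int[mu]_x (w x * phi i x) + e &
    \sum_(0 <= i < N) \int[mu]_x (`|w x - k i| * phi i x) <= e].
Proof.
move=> bw w01 iw e0.
have w0 x : 0 <= w x by have /andP[] := w01 x.
have [s rs Hs] := integral_box_cvg w0 iw bw e0 (Num.max r 0).
move: rs; rewrite ge_max => /andP[rs s0].
have e2 : 0 < e / 2 by rewrite divr_gt0.
have [c [k [cc ck k1 Hc]]] := continuous_box_approx (s + 1) bw w01 e2.
pose S := \int[mu]_x box (s + 1) x.
have S0 : 0 <= S by apply: Rintegral_ge0 => x _; exact: box_ge0.
have S1 : 0 < S + 1 by rewrite ltr_wpDl.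
pose e3 := e / 2 / (S + 1).
have e30 : 0 < e3 by rewrite divr_gt0.
(* cells of length h = l / N, starting at a = -(s + 1) and ending at s *)
pose l := s * 2 + 1; have l0 : 0 < l by rewrite ltr_wpDl// mulr_ge0.
have [N [N0 lN1 Hd]] : exists N : nat, [/\ (0 < N)%N, l / N%:R <= 1 &
    forall x y, - (s + 1) <= x <= s + 1 -> `|x - y| <= 2 * (l / N%:R) ->
      `|c x - c y| <= e3].
  have /(_ (- (s + 1)) (s + 1)) H := uniformly_continuous_segment _ _ cc e30.
  have [d d0 Hd] : exists2 d, 0 < d & forall x y, - (s + 1) <= x <= s + 1 ->
      `|x - y| <= d -> `|c x - c y| <= e3.
    near (0 : R)^'+ => d; exists d; first by near: d; exact: nbhs_right_gt.
    by near: d; exact: H.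
  near \oo => N; exists N; split.
  - by near: N; exact: nbhs_infty_gt.
  - rewrite ler_pdivrMr ?mul1r; last by rewrite ltr0n; near: N; exact: nbhs_infty_gt.
    by near: N; exact: nbhs_infty_ger.
  - move=> x y xs xy; apply: Hd => //; apply: (le_trans xy).
    rewrite mulrA ler_pdivrMr; last by rewrite ltr0n; near: N; exact: nbhs_infty_gt.
    by rewrite -ler_pdivrMl//; near: N; exact: nbhs_infty_ger.
pose h := l / N%:R; pose a := - (s + 1).
have h0 : 0 < h by rewrite divr_gt0// ltr0n.
have Nh : a + N%:R * h = s.
  rewrite /h mulrCA divff ?mulr1; last by rewrite pnatr_eq0 -lt0n.
  by rewrite /a /l; ring.
pose xi (i : nat) := a + i%:R * h.
have xiS i : xi i.+1 = xi i + h by rewrite /xi -natr1 mulrDl mul1r addrA.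
have xi_le i : xi i <= xi i.+1 by rewrite xiS lerDl ltW.
pose phi i := plateau (xi i) (xi i.+1) h.
have sumphi x : \sum_(0 <= i < N) phi i x = plateau a s h x.
  by rewrite /phi /xi sum_plateau Nh.
have tphi i : tame (phi i) by exact: plateau_tame.
have phi0 i x : 0 <= phi i x by exact: plateau_ge0.
have as_ : a <= s by rewrite /a; lra.
exists N, phi, (fun i => c (xi i)); split.
- by move=> i; split; [exact: plateau_smooth|exact: plateau_bounded_support|].
- by move=> i; have /andP[-> H] := ck (xi i); rewrite (le_lt_trans H).
- move=> x; rewrite sumphi plateau_le1// andbT boxE; case: (leP `|x| r) => xr /=.
    move: xr; rewrite ler_norml => /andP[xr1 xr2].
    rewrite /plateau (@ramp_eq0 _ s)//; last exact: le_trans xr2 rs.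
    rewrite ramp_eq1 ?subr0//; apply: le_trans xr1.
    apply: (@le_trans _ _ (a + 1)); first by rewrite lerD2l.
    by rewrite /a opprD subrK lerN2.
  exact: plateau_ge0.
- have tw i : tame (fun x => w x * phi i x) by have tp := tphi i; tame_tac.
  have [tws <-] := tame_sum N tw.
  apply: (le_trans Hs); rewrite lerD2r; apply: le_integral_tame; [tame_tac|by []|] => x.
  rewrite -mulr_sumr ler_wpM2l// sumphi boxE; case: (leP `|x| s) => xs /=; last exact: plateau_ge0.
  move: xs; rewrite ler_norml => /andP[xs1 xs2].
  rewrite /plateau (@ramp_eq0 _ s)// ramp_eq1 ?subr0//; apply: le_trans xs1.
  apply: (@le_trans _ _ (a + 1)); first by rewrite lerD2l.
  by rewrite /a opprD subrK.
- have tw i : tame (fun x => `|w x - c (xi i)| * phi i x) by have tp := tphi i; tame_tac.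
  have [tws <-] := tame_sum N tw.
  have bc : bounded_mfun c.
    split; first exact: continuous_measurable_fun.
    by exists k => x; have /andP[c0 c1] := ck x; rewrite ger0_norm.
  have tb := box_tame (s + 1).
  apply: (@le_trans _ _ (\int[mu]_x (`|w x - c x| * box (s + 1) x + e3 * box (s + 1) x))).
    apply: le_integral_tame; [by []|tame_tac|] => x.
    apply: (@le_trans _ _ ((`|w x - c x| + e3) * plateau a s h x)).
      rewrite -sumphi mulr_sumr; apply: ler_sum_nat => i /andP[_ iN].
      have [/andP[xx1 xx2]|xx] := boolP (xi i <= x <= xi i + 2 * h); last first.
        rewrite /phi plateau_eq0 ?mulr0// xiS.
        move: xx; rewrite negb_and -!ltNge mulr_natl mulr2n addrA.
        by move=> /orP[/ltW|/ltW]; [left|right].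
      rewrite ler_wpM2r//; apply: le_trans (ler_distD (c x) _ _) _.
      rewrite lerD2l distrC; apply: Hd.
        have xia : a <= xi i by rewrite /xi lerDl mulr_ge0// ltW.
        have xis : xi i <= s.
          by rewrite -Nh /xi lerD2l ler_wpM2r ?(ltW h0)// ler_nat ltnW.
        by rewrite xia (le_trans xis)// lerDl.
      by rewrite distrC ger0_norm ?subr_ge0// lerBlDl.
    rewrite -mulrDl ler_wpM2l//; first by rewrite addr_ge0// ltW.
    rewrite boxE; case: (leP `|x| (s + 1)) => xs /=; first exact: plateau_le1.
    rewrite plateau_eq0// /a; move: xs; rewrite ltr_normr => /orP[H|H].
      by right; apply: (le_trans _ (ltW H)); rewrite lerD2l.
    by left; rewrite lerNr ltW.
  rewrite integral_tameD; [|tame_tac..]; rewrite integral_tameZ//.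
  rewrite [e]splitr lerD// -/S /e3 -mulrA ler_piMr ?(ltW e2)// mulrC ler_pdivrMr//.
  by rewrite mul1r lerDl.
Unshelve. all: by end_near. Qed.

End step_approximation.

(** * Convergence of entropy flows at fixed times *)

Lemma powR_lt1_cvg0 (R : realType) (k : R) : 0 <= k < 1 ->
  k `^ m @[m --> +oo] --> 0.
Proof.
move=> /andP[k0 k1]; apply/cvgrPdist_le => e e0.
move: k0; rewrite le_eqVlt => /predU1P[<-|k0].
  near=> m; have m0 : 0 < m by near: m; apply: nbhs_pinfty_gt; exact: num_real.
  by rewrite powR0 ?gt_eqF// subrr normr0 ltW.
have /cvgrPdist_le/(_ _ e0) := @cvgr_expR R.
have c0 : 0 < - ln k by rewrite oppr_gt0 ln_lt0// k0.
move=> [X [Xr HX]]; near=> m.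
have mX : X / - ln k < m by near: m; apply: nbhs_pinfty_gt; exact: num_real.
rewrite sub0r normrN ger0_norm ?powR_ge0// /powR gt_eqF//.
have -> : m * ln k = - (m * - ln k) by rewrite mulrN opprK.
have := HX (m * - ln k); rewrite sub0r normrN ger0_norm ?expR_ge0//; apply.
by rewrite -ltr_pdivrMr.
Unshelve. all: by end_near. Qed.

Section flow_limit.
Context {R : realType}.
Implicit Types (w f : R -> R) (u : R * R -> R) (k m M e r t T : R).
Local Notation mu := (leb R).

(** Uses |a - k| = a + k - 2 min(a, k) for a = u and for a = w, and the lower
    bound on the truncated mass in between. *)
Lemma flow_cell_estimate m M w u k f t : 1 < m -> entropy_flow m M w u ->
  bounded_mfun w -> 0 <= k -> smooth1 f ->
  bounded_support f -> (forall x, 0 <= f x) -> 0 < t ->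
  \int[mu]_x (`|u (x, t) - w x| * f x) <=
    (slice_integral u f t - \int[mu]_x (w x * f x))
    + 2 * \int[mu]_x (`|w x - k| * f x)
    + 2 * ((k `^ m * \int[mu]_x `|f^`()%classic x|) * t).
Proof.
move=> m1 Hu bw k0 sf bf f0 t0; have tf := smooth1_tame sf bf.
have bs : bounded_mfun (fun x => u (x, t)).
  by apply: bounded_mfun_slice; exact: flow_bounded Hu.
have := truncated_mass_ge m1 Hu bw k0 sf bf f0 t0.
set C := _ * t; set A := slice_integral _ _ _; set B := \int[mu]_x (Num.min (w x) k * f x).
move=> ABC.
have E (p : R -> R) : bounded_mfun p -> \int[mu]_x (`|p x - k| * f x) =
    \int[mu]_x (p x * f x) + k * \int[mu]_x f x - 2 * \int[mu]_x (Num.min (p x) k * f x).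
  move=> bp; rewrite -!integral_tameZ; [|tame_tac..].
  rewrite -integral_tameD; [|tame_tac..].
  rewrite -integral_tameB; [|tame_tac..].
  apply: eq_Rintegral => x _; rewrite mulrA -mulrDl -mulrBl; congr (_ * _).
  rewrite /Num.min; case: ltP => H.
    by rewrite ltr0_norm ?subr_lt0//; ring.
  by rewrite ger0_norm ?subr_ge0//; ring.
apply: (@le_trans _ _ (\int[mu]_x (`|u (x, t) - k| * f x + `|w x - k| * f x))).
  apply: le_integral_tame; [tame_tac..|] => x.
  by rewrite -mulrDl ler_wpM2r// (distrC (w x)) ler_distD.
rewrite integral_tameD; [|tame_tac..].
have Ew := E _ bw; rewrite (E _ bs) -/A.
have -> : \int[mu]_x (Num.min (u (x, t)) k * f x) = A by [].
have -> : \int[mu]_x (u (x, t) * f x) = slice_integral u f t by [].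
move: ABC Ew; rewrite -/B; move: (slice_integral u f t) A B C.
move: (\int[mu]_x (w x * f x)) (k * _) (\int[mu]_x (`|w x - k| * f x)).
by clear => W K D U A B C; lra.
Qed.

(** Summing the cell estimates, the first-order terms add up to a difference of
    masses, controlled because no mass is created. *)
Lemma flow_L1_small w e r T : bounded_mfun w -> (forall x, 0 <= w x <= 1) ->
  mu.-integrable setT (EFin \o w) -> 0 < e -> 0 < T ->
  \forall m \near +oo, forall M u, entropy_flow m M w u ->
    forall t, 0 < t <= T -> \int[mu]_x (`|u (x, t) - w x| * box r x) <= e.
Proof.
move=> bw w01 iw e0 T0; have e4 : 0 < e / 4 by rewrite divr_gt0.
have [N [phi [k [Hphi k01 sphi Hw Hk]]]] := smooth_step_approximation r bw w01 iw e4.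
pose K i := \int[mu]_x `|(phi i)^`()%classic x|.
have K0 i : 0 <= K i by apply: Rintegral_ge0.
pose S m := \sum_(0 <= i < N) (k i `^ m * K i).
have cvS : S m @[m --> +oo] --> 0.
  rewrite /S; elim: (N) => [|n IH].
    by under eq_fun do rewrite big_nil; exact: cvg_cst.
  have cvn : k n `^ m * K n @[m --> +oo] --> 0 * K n.
    by apply: cvgM; [exact: powR_lt1_cvg0|exact: cvg_cst].
  have cv := cvgD IH cvn; rewrite mul0r addr0 in cv.
  rewrite (_ : (fun m => _) = (fun m => \sum_(0 <= i < n) (k i `^ m * K i)) \+
    (fun m => k n `^ m * K n)); first exact: cv.
  by apply/funext => m; rewrite big_nat_recr.
have eT : 0 < e / 8 / T by rewrite !divr_gt0.
have /cvgrPdist_le/(_ _ eT) cvS' := cvS.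
near=> m.
have m1 : 1 < m by near: m; apply: nbhs_pinfty_gt; exact: num_real.
have Sm : S m <= e / 8 / T.
  apply: le_trans (ler_norm _) _; rewrite -normrN -sub0r; near: m; exact: cvS'.
move=> M u Hu t /andP[t0 tT].
have bu := flow_bounded Hu.
have bs : bounded_mfun (fun x => u (x, t)) by exact: bounded_mfun_slice.
have tphi i : tame (phi i) by have [sf bf _] := Hphi i; exact: smooth1_tame.
have tP : tame (fun x => \sum_(0 <= i < N) phi i x) by have [] := tame_sum N tphi.
have tu i : tame (fun x => u (x, t) * phi i x) by have tp := tphi i; tame_tac.
have td i : tame (fun x => `|u (x, t) - w x| * phi i x) by have tp := tphi i; tame_tac.
have [tds Ed] := tame_sum N td; have [tus Eu] := tame_sum N tu.
have tb := box_tame r.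
apply: (@le_trans _ _ (\sum_(0 <= i < N) \int[mu]_x (`|u (x, t) - w x| * phi i x))).
  rewrite -Ed; apply: le_integral_tame; [tame_tac|by []|] => x.
  by rewrite -mulr_sumr ler_wpM2l//; have /andP[] := sphi x.
apply: (@le_trans _ _ (\sum_(0 <= i < N)
   ((slice_integral u (phi i) t - \int[mu]_x (w x * phi i x))
    + 2 * \int[mu]_x (`|w x - k i| * phi i x)
    + 2 * ((k i `^ m * K i) * t)))).
  apply: ler_sum => i _; have [sf bf f0] := Hphi i; have /andP[k0 _] := k01 i.
  exact: (flow_cell_estimate m1 Hu bw k0 sf bf f0 t0).
rewrite !big_split/= sumrN -!mulr_sumr -mulr_suml -/(S m).
have mass : \sum_(0 <= i < N) slice_integral u (phi i) t <= \int[mu]_x w x.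
  have -> : \sum_(0 <= i < N) slice_integral u (phi i) t =
      slice_integral u (fun x => \sum_(0 <= i < N) phi i x) t.
    by rewrite /slice_integral -Eu; apply: eq_Rintegral => x _; rewrite mulr_sumr.
  apply: (mass_le m1 Hu bw w01 iw tP _ t0) => x; have /andP[H1 H2] := sphi x.
  by rewrite H2 andbT (le_trans _ H1)// box_ge0.
have St : S m * t <= e / 8.
  apply: (@le_trans _ _ (e / 8 / T * T)); last by rewrite divfK// gt_eqF.
  apply: ler_pM => //; last exact: ltW.
  by apply: sumr_ge0 => i _; rewrite mulr_ge0// powR_ge0.
move: mass Hw Hk St; move: (\sum_(0 <= i < N) slice_integral _ _ _) (S m * t).
move: (\sum_(0 <= i < N) _) (\sum_(0 <= i < N) _) (\int[mu]_x w x).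
clear => x1 x2 x3 x4 x5 h1 h2 h3 h4.
have [E4 E8] : e / 4 = 2 * (e / 8) /\ e = 8 * (e / 8) by split; field.
by rewrite [leRHS]E8; rewrite E4 in h2 h3; lra.
Unshelve. all: by end_near. Qed.

End flow_limit.

(** * Kruzkov solutions as entropy flows *)

(** Stated for arbitrary sets so as to apply to compact sets of the plane
    without discussing their measurability in the product. *)
Lemma ge0_le_integral_subset d (T : measurableType d) (R : realType)
    (mu : {measure set T -> \bar R}) (A B : set T) (f : T -> \bar R) :
  (forall x, 0 <= f x)%E -> A `<=` B ->
  (\int[mu]_(x in A) f x <= \int[mu]_(x in B) f x)%E.
Proof.
move=> f0 AB.
have p0 (C : set T) x : (0 <= (f \_ C) x)%E by rewrite patchE; case: ifP.
rewrite [leLHS]integral_mkcond [leRHS]integral_mkcond !ge0_integralTE//.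
apply: le_ereal_sup => _ [h /= hf <-]; exists h => // x.
apply: le_trans (hf x) _; rewrite !patchE; case: ifPn => [|_].
  by rewrite inE => /AB; rewrite -inE => ->.
by case: ifP.
Qed.

#[global] Instance leb_ae_filter (R : realType) :
  Filter (almost_everywhere (leb R)) := ae_filter_ringOfSetsType (leb R).

#[global] Instance leb2_ae_filter (R : realType) :
  Filter (almost_everywhere (leb2 R)) := ae_filter_ringOfSetsType (leb2 R).

Section kruzkov_flow.
Context {R : realType}.
Implicit Types (w f g : R -> R) (u : R * R -> R) (m M : R).
Local Notation mu := (leb R).
Local Notation mu2 := (leb2 R).

Lemma measurable_tensor f g : measurable_fun setT f -> measurable_fun setT g ->
  measurable_fun setT (tensor f g).
Proof.
move=> mf mg; apply: measurable_funM.
  exact: (measurableT_comp mf measurable_fst).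
exact: (measurableT_comp mg measurable_snd).
Qed.

Lemma smooth1_measurable f : smooth1 f -> measurable_fun setT f.
Proof. by move=> /smooth1_continuous; exact: continuous_measurable_fun. Qed.

(** A null set contains no interval, so good times accumulate at 0. *)
Lemma closure_positive_conull (E : set R) : mu.-negligible E ->
  closure [set t | 0 < t /\ ~ E t] 0.
Proof.
move=> nE B /nbhs_ballP[e /= e0 eB].
have : ~ (`]0, e[%classic `<=` E).
  move=> sE; have /measure_negligible := @negligibleS _ _ _ mu _ _ sE nE.
  move=> /(_ (measurable_itv _)); rewrite /leb /= lebesgue_measure_itv/=.
  by rewrite lte_fin e0 -EFinB => -[] /eqP; rewrite subr0 gt_eqF.
move=> /existsNP[t /not_implyP[/=]]; rewrite in_itv/= => /andP[t0 te] nEt.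
exists t; split => //; apply: eB.
by rewrite /ball/= sub0r normrN gtr0_norm.
Qed.

(** The truncation changes u only on a null set, and enlarges neither the L^1
    distances between slices nor those to the initial value. *)
Lemma kruzkov_flow m w u : 1 < m -> (forall x, w x <= 1) ->
  measurable_fun setT w -> {ae mu, forall x, 0 <= w x} ->
  kruzkov_solution m (fun=> 0) w u -> continuous_L1loc u ->
  exists M, [/\ 0 <= M, {ae mu2, forall z, halfplane R z -> 0 <= u z <= M} &
    entropy_flow m M (fun x => Num.max (w x) 0) (truncation M u)].
Proof.
move=> m1 w1 mw w0 [[mu_ [M0 HM0]] Hent [E [nE tr]]] cu.
pose M := Num.max M0 1.
have M1 : 1 <= M by rewrite le_max lexx orbT.
have Mge0 : 0 <= M by exact: le_trans M1.
have HM : {ae mu2, forall z, halfplane R z -> 0 <= u z <= M}.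
  apply: filterS HM0 => z H /H /andP[-> uM]; rewrite (le_trans uM)//.
  by rewrite le_max lexx.
have bT := truncation_bounded Mge0 mu_.
exists M; split => //; split => //.
- by move=> z; exact: truncation_itv.
- by move=> z z0; rewrite /truncation ltNge z0.
- exact: truncation_continuous_L1loc.
- move=> k f g k0 sf sg bf pg f0 g0.
  have bg := positive_support_bounded pg.
  have [r fr] := bf; have [a [b [a0 gab]]] := pg.
  have tst : test2 (tensor f g) by exact: test2_tensor a0 fr gab.
  have pos z : 0 <= tensor f g z by rewrite mulr_ge0.
  have := Hent k _ k0 tst pos.
  rewrite dt_tensor// dx_tensor//.
  have mH := @measurable_halfplane R.
  have mt1 : measurable_fun (halfplane R) (tensor f g^`()%classic).
    apply: measurable_funTS; apply: measurable_tensor; apply: smooth1_measurable => //.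
    exact: smooth1_derive.
  have mt2 : measurable_fun (halfplane R) (tensor f^`()%classic g).
    apply: measurable_funTS; apply: measurable_tensor; apply: smooth1_measurable => //.
    exact: smooth1_derive.
  have mint (v : R * R -> R) : measurable_fun (halfplane R) v ->
      measurable_fun (halfplane R) (fun z => (`|v z - k| * tensor f g^`()%classic z
       + `|v z `^ m - k `^ m| * tensor f^`()%classic g z)%:E).
    move=> mv; apply/measurable_EFinP; apply: measurable_funD; apply: measurable_funM => //.
      by apply: measurableT_comp => //; exact: measurable_funB.
    apply: measurableT_comp => //; apply: measurable_funB => //.
    exact: (measurableT_comp (measurable_powR m)).
  under eq_Rintegral do rewrite mulr0 mul0r addr0.
  move=> H; rewrite (_ : Rintegral _ _ _ = \int[mu2]_(z in halfplane R)
    (`|u z - k| * tensor f g^`()%classic z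
     + `|u z `^ m - k `^ m| * tensor f^`()%classic g z)); first exact: H.
  congr fine; apply: ae_eq_integral => //.
  + by apply: mint; apply: measurable_funTS; case: bT.
  + exact: mint.
  + by apply: filterS HM => z HM' Hz; rewrite truncation_id//; exact: HM'.
- exists (within [set t | 0 < t /\ ~ E t] (nbhs (0 : R))); split.
  + by apply: within_nbhs_proper; exact: closure_positive_conull.
  + move=> e e0; rewrite near_withinE; near=> t => -[t0 _].
    by rewrite t0/=; near: t; exact: lt_nbhsl.
  + move=> r r0; apply: (@squeeze_cvge _ _ _ _ (cst 0%E) _
      (fun t => dist_L1 r (slice u t) w)).
    * rewrite near_withinE; near=> t => -[t0 _].
      rewrite integral_ge0//=; have [mt _ _] := cu.1 _ t0.
      have [mT _] := bounded_mfun_slice t bT.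
      apply: le_dist_L1 => //; first exact: measurable_maxr.
      move=> x; rewrite /slice /truncation/= t0.
      have -> : Num.max (w x) 0 = Num.min (Num.max (w x) 0) M.
        by rewrite min_l// ge_max Mge0 andbT (le_trans (w1 x)).
      exact: min_max_lipschitz.
    * exact: cvg_cst.
    * exact: tr.
Unshelve. all: by end_near. Qed.

End kruzkov_flow.

(** * The limit of the conservation laws *)

Lemma ge0_cvge0 (T : Type) (F : set_system T) {FF : Filter F} (R : realType)
    (I : T -> \bar R) : (forall t, 0 <= I t)%E ->
  (forall e : R, 0 < e -> \forall t \near F, (I t <= e%:E)%E) ->
  I t @[t --> F] --> 0%E.
Proof.
move=> I0 H; apply/fine_cvgP; split.
  apply: filterS (H 1 ltr01) => t It.
  by rewrite ge0_fin_numE// (le_lt_trans It)// ltry.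
apply/cvgrPdist_le => e e0; apply: filterS (H e e0) => t It.
rewrite sub0r normrN ger0_norm ?fine_ge0// -lee_fin fineK//.
by rewrite ge0_fin_numE// (le_lt_trans It)// ltry.
Qed.

Section strong_limit.
Context {R : realType}.
Local Notation mu := (leb R).
Local Notation mu2 := (leb2 R).

Definition window (r : R) : set (R * R) := `[- r, r]%classic `*` `]0, r]%classic.

Lemma measurable_window r : measurable (window r).
Proof. exact: measurableX. Qed.

Lemma compact_sub_window (K : set (R * R)) : compact K -> K `<=` halfplane R ->
  exists2 r, 0 < r & K `<=` window r.
Proof.
move=> cK KH; have [M [Mr hM]] := compact_bounded cK.
exists (`|M| + 1); first by rewrite ltr_wpDl.
move=> z Kz; have zM : `|z| <= `|M| + 1.
  by apply: hM => //; rewrite ltr_pwDr// ler_norm.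
have := KH _ Kz; rewrite /halfplane/= => z0.
move: zM; rewrite prod_normE/= ge_max => /andP[z1 z2].
split; rewrite /= in_itv/=; first by rewrite -ler_norml.
by rewrite z0 (le_trans (ler_norm _)).
Qed.

Definition time_box (r : R) : R -> R := \1_(`]0, r]%classic : set R).

Lemma time_boxE r t : time_box r t = (0 < t <= r)%R%:R.
Proof. by rewrite /time_box indicE mem_setE in_itv. Qed.

Lemma time_box_tame r : tame (time_box r).
Proof.
split; last first.
  exists `|r| => t rt; rewrite time_boxE; case: (ltP 0 t) => //= t0.
  by rewrite leNgt (le_lt_trans (ler_norm r))// -(gtr0_norm t0).
split; first exact: measurable_indic.
by exists 1 => t; rewrite time_boxE; case: (_ && _); rewrite ?normr1 ?normr0.
Qed.

Lemma patch_window (G : R * R -> R) r :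
  (G \_ (window r)) = fun z => G z * tensor (box r) (time_box r) z.
Proof.
apply/funext => z; rewrite patchE /tensor boxE time_boxE; case: ifPn => zw.
  move: zw; rewrite inE => -[/=]; rewrite !in_itv/= -ler_norml => -> ->.
  by rewrite !mulr1.
case: (boolP (`|z.1| <= r)) => H1; last by rewrite mul0r mulr0.
case: (boolP (0 < z.2 <= r)) => H2; last by rewrite !mulr0.
by case/negP: zw; rewrite inE; split; rewrite /= in_itv//= -ler_norml.
Qed.

Lemma integral_window (G : R * R -> R) r : bounded_mfun G ->
  (\int[mu2]_(z in window r) (G z)%:E)%E =
  (\int[mu]_t (slice_integral G (box r) t * time_box r t))%:E.
Proof.
move=> bG; have tb := box_tame r; have tt := time_box_tame r.
have t0 t : t <= 0 -> time_box r t = 0 by move=> tle; rewrite time_boxE ltNge tle.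
have [iG <-] := fubini_tensor bG tb tt t0.
rewrite /Rintegral fineK; last first.
  by apply: (integrable_fin_num (mu := mu2)) => //; exact: measurable_halfplane.
rewrite [LHS]integral_mkcond [RHS]integral_mkcond; apply: eq_integral => z _.
rewrite -[LHS]/(((EFin \o G) \_ (window r)) z) restrict_EFin patch_window.
rewrite patchE; case: ifPn => //; rewrite notin_setE /halfplane/= => /negP.
by rewrite -leNgt => z0; rewrite /tensor t0// !mulr0.
Qed.

Lemma integral_window_le (G : R * R -> R) r e : bounded_mfun G -> 0 < r ->
  (forall t, 0 < t <= r -> slice_integral G (box r) t <= e) ->
  \int[mu]_t (slice_integral G (box r) t * time_box r t) <= e * r.
Proof.
move=> bG r0 He; have tb := box_tame r; have tt := time_box_tame r.
have -> : e * r = e * \int[mu]_t time_box r t.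
  congr (_ * _); rewrite /Rintegral /time_box.
  rewrite integral_indic//= setIT /leb /= lebesgue_measure_itv/= lte_fin r0.
  by rewrite oppr0 addr0.
rewrite -integral_tameZ//; apply: le_integral_tame; [tame_tac..|] => t.
rewrite time_boxE; case: (boolP (0 < t <= r)) => H; last by rewrite !mulr0.
by rewrite !mulr1 He.
Qed.

Lemma in_L1_Linfty_integrable (u0 : R -> R) : in_L1_Linfty u0 ->
  measurable_fun setT u0 /\ mu.-integrable setT (EFin \o u0).
Proof.
move=> [u1 _]; split; last exact/Lfun1_integrable.
by move: u1 => /sub_Lfun_mfun; rewrite inE.
Qed.

(** When u0 >= 0 almost everywhere, a representative of min(u0, 1) with values
    in [0, 1] everywhere. *)
Definition clip (u0 : R -> R) (x : R) : R := Num.max (Num.min (u0 x) 1) 0.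

Lemma clip_itv u0 x : 0 <= clip u0 x <= 1.
Proof. by rewrite /clip le_max lexx orbT ge_max ler01 andbT ge_min lexx orbT. Qed.

Lemma clip_id u0 x : 0 <= u0 x -> clip u0 x = Num.min (u0 x) 1.
Proof. by move=> u00; rewrite /clip max_l// le_min u00 ler01. Qed.

Lemma clip_bounded u0 : measurable_fun setT u0 -> bounded_mfun (clip u0).
Proof.
move=> mu0; split.
  by apply: measurable_maxr => //; exact: measurable_minr.
by exists 1 => x; have /andP[c0 c1] := clip_itv u0 x; rewrite ger0_norm.
Qed.

Lemma clip_integrable u0 : measurable_fun setT u0 ->
  mu.-integrable setT (EFin \o u0) -> mu.-integrable setT (EFin \o clip u0).
Proof.
move=> mu0; apply: le_integrable => //.
  by apply/measurable_EFinP; case: (clip_bounded mu0).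
move=> x _; rewrite lee_fin /clip.
have := normr_ge0 (u0 x); have := ler_norm (u0 x); move: (u0 x) => a a1 a0.
rewrite ger0_norm; last by rewrite le_max lexx orbT.
by rewrite ge_max a0 andbT ge_min a1.
Qed.

(** A compact set lies in a window on which the distance at fixed times is
    uniformly small; integrate over time. *)
Lemma strong_limit (u0 : R -> R) (U : R -> R * R -> R) :
  {ae mu, forall x, 0 <= u0 x} -> in_L1_Linfty u0 ->
  (forall m, 1 < m -> continuous_L1loc (U m)) ->
  (forall m, 1 < m ->
    kruzkov_solution m (fun=> 0) (fun x => Num.min (u0 x) 1) (U m)) ->
  cvg_L1loc_halfplane U (fun z => clip u0 z.1).
Proof.
move=> u00 /in_L1_Linfty_integrable[mu0 iu0] cU sU K cK KH.
have [r r0 Kr] := compact_sub_window cK KH.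
have bw := clip_bounded mu0; have iw := clip_integrable mu0 iu0.
have bw2 : bounded_mfun (fun z : R * R => clip u0 z.1).
  case: (bw) => mw [C hC]; split; last by exists C => z.
  exact: (measurableT_comp mw measurable_fst).
apply: ge0_cvge0 => [m|e e0].
  by apply: integral_ge0 => z _; rewrite lee_fin.
have er : 0 < e / r by rewrite divr_gt0.
have small_near := flow_L1_small r bw (clip_itv u0) iw er r0.
near=> m; have m1 : 1 < m by near: m; apply: nbhs_pinfty_gt; exact: num_real.
have small : forall M u, entropy_flow m M (clip u0) u ->
    forall t, 0 < t <= r -> \int[mu]_x (`|u (x, t) - clip u0 x| * box r x) <= e / r.
  by near: m; exact: small_near.
have w1 x : Num.min (u0 x) 1 <= 1 by rewrite ge_min lexx orbT.
have mw : measurable_fun setT (fun x => Num.min (u0 x) 1) by exact: measurable_minr.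
have w0 : {ae mu, forall x, 0 <= Num.min (u0 x) 1}.
  by apply: filterS u00 => x x0; rewrite le_min x0 ler01.
have [M [M0 HM flow]] := kruzkov_flow m1 w1 mw w0 (sU _ m1) (cU _ m1).
have [[mU _] _ _] := sU _ m1.
have bT := truncation_bounded M0 mU.
have mWH : window r `<=` halfplane R by move=> z [_]; rewrite /= in_itv/= => /andP[].
have mW := measurable_window r.
have bG : bounded_mfun (fun z => `|truncation M (U m) z - clip u0 z.1|).
  by apply: bounded_mfun_norm; exact: bounded_mfunB.
apply: (@le_trans _ _ (\int[mu2]_(z in window r) `|U m z - clip u0 z.1|%:E)%E).
  by apply: ge0_le_integral_subset => // z; rewrite lee_fin.
rewrite (_ : integral _ _ _ =
    \int[mu2]_(z in window r) `|truncation M (U m) z - clip u0 z.1|%:E)%E.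
  rewrite (integral_window r bG) lee_fin -[leRHS](divfK (lt0r_neq0 r0)).
  apply: integral_window_le => // t tr; exact: small flow t tr.
apply: ae_eq_integral => //.
- apply/measurable_EFinP; apply: measurableT_comp => //; apply: measurable_funB.
    by apply: measurable_funS mU => //; exact: measurable_halfplane.
  by apply: measurable_funTS; case: bw2.
- by apply/measurable_EFinP; apply: measurable_funTS; case: bG.
- apply: filterS HM => z HM' Wz; rewrite truncation_id//; first exact: mWH.
  by apply: HM'; exact: mWH.
Unshelve. all: by end_near. Qed.

(** The function min(u0, 1) is its own stationary limit, with psi = 0. *)
Lemma stationary_limit_clip (u0 : R -> R) :
  {ae mu, forall x, 0 <= u0 x} -> in_L1_Linfty u0 ->
  stationary_limit (clip u0) (fun x => Num.min (u0 x) 1).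
Proof.
move=> u00 /in_L1_Linfty_integrable[mu0 iu0]; split.
- by case: (clip_bounded mu0).
- by apply: nearW => x; exact: clip_itv.
exists (fun=> 0); split.
- exact: nearW.
- split.
    by apply/Lfun1_integrable; exact: integrable0.
  apply/andP; split; rewrite inE.
    exact: (measurable_cst (0 : R)).
  exact: (@finite_norm_cst0 _ _ R mu +oo%E (leey 1)).
- move=> eta [seta _].
  have -> : \int[mu]_x (0 * eta^`()%classic x) = 0.
    by rewrite /Rintegral; under eq_integral do rewrite mul0r; rewrite integral0.
  rewrite subr0; congr fine; apply: ae_eq_integral => //.
  + apply/measurable_EFinP; apply: measurable_funM.
      by case: (clip_bounded mu0).
    exact: smooth1_measurable.
  + apply/measurable_EFinP; apply: measurable_funM; first exact: measurable_minr.
    exact: smooth1_measurable.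
  + by apply: filterS u00 => x x0 _; rewrite clip_id.
- by apply: nearW.
Qed.

End strong_limit.

(** * The fundamental lemma of the calculus of variations *)

Section fundamental_lemma.
Context {R : realType}.
Local Notation mu := (leb R).

(** This plateau equals 1 on the middle half of the ball of radius r. *)
Lemma integral_plateau_ge (x r : R) : 0 < r ->
  r <= \int[mu]_y plateau (x - r) (x + r / 2) (r / 2) y.
Proof.
move=> r0; have r2 : 0 < r / 2 by rewrite divr_gt0.
have le1 : x - r <= x + r / 2 by rewrite lerD2l; lra.
have tp := plateau_tame r2 le1.
have E : r = \int[mu]_y (\1_(`[x - r / 2, x + r / 2]%classic : set R) y : R).
  rewrite /Rintegral integral_indic//= setIT /leb /= lebesgue_measure_itv/= lte_fin.
  rewrite ifT; last by lra.
  by rewrite -EFinB/=; lra.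
have ti : tame (\1_(`[x - r / 2, x + r / 2]%classic : set R) : R -> R).
  split; last first.
    exists (`|x| + r) => y Hy; rewrite indicE mem_setE in_itv/=.
    case: (boolP (_ && _)) => // /andP[y1 y2]; exfalso; move: Hy; apply/negP.
    rewrite -leNgt ler_norml; have := ler_norm x; have := ler_norm (- x).
    by rewrite normrN => ? ?; apply/andP; split; lra.
  split; first exact: measurable_indic.
  by exists 1 => y; rewrite indicE; case: (_ \in _); rewrite ?normr1 ?normr0.
rewrite [leLHS]E; apply: le_integral_tame => //.
move=> y; rewrite indicE mem_setE in_itv/=; case: (boolP (_ && _)) => [/andP[y1 y2]|_] /=.
  rewrite /plateau ramp_eq1//; last by lra.
  by rewrite ramp_eq0 ?subr0.
exact: plateau_ge0.
Qed.

(** At a Lebesgue point with a negative value, testing with a plateau on a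
    small ball would give a negative integral. *)
Lemma ae_ge0_of_tests (h : R -> R) : bounded_mfun h ->
  (forall f, smooth1 f -> bounded_support f -> (forall x, 0 <= f x) ->
    0 <= \int[mu]_x (h x * f x)) ->
  {ae mu, forall x, 0 <= h x}.
Proof.
move=> bh H; have lh := bounded_locally_integrable bh.
have := lebesgue_differentiation lh.
apply: filterS => x; rewrite /lebesgue_pt => /fine_cvgP[fd cd].
rewrite leNgt; apply/negP => hx.
have e0 : 0 < - h x / 4 by rewrite divr_gt0// oppr_gt0.
have /cvgrPdist_le/(_ _ e0) cd' := cd.
have [r [r0 fdr dr]] : exists r, [/\ 0 < r, davg h x r \is a fin_num &
    fine (davg h x r) <= - h x / 4].
  near (0 : R)^'+ => r; exists r; split.
  - by near: r; exact: nbhs_right_gt.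
  - by near: r; exact: fd.
  - apply: le_trans (ler_norm _) _; rewrite -normrN -sub0r.
    by near: r; exact: cd'.
(* supported in the ball of radius r around x, where f <= 1 *)
pose f := plateau (x - r) (x + r / 2) (r / 2).
have r2 : 0 < r / 2 by rewrite divr_gt0.
have le1 : x - r <= x + r / 2 by rewrite lerD2l; lra.
have tf : tame f by exact: plateau_tame.
have f0 y : 0 <= f y by exact: plateau_ge0.
have Hf : 0 <= \int[mu]_y (h y * f y).
  by apply: H => //; [exact: plateau_smooth|exact: plateau_bounded_support].
pose D y := `|h y - h x|.
have bD : bounded_mfun D.
  by apply: bounded_mfun_norm; apply: bounded_mfunB => //; exact: bounded_mfun_cst.
have fD : \int[mu]_y (D y * f y) <= (r *+ 2) * (- h x / 4).
  have mB : measurable (ball x r : set R) by exact: measurable_ball.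
  have lb : lebesgue_measure (ball x r) = (r *+ 2)%:E by apply: lebesgue_measure_ball; exact: ltW.
  have r20 : 0 < r *+ 2 by rewrite pmulrn_lgt0.
  have ID : ((\int[mu]_(y in ball x r) (D y)%:E) = (r *+ 2)%:E * davg h x r)%E.
    rewrite /davg /iavg lb muleA [(_ * _^-1)%E]muleC mulVe ?mul1e//.
    by rewrite eqe gt_eqF.
  rewrite -lee_fin EFinM; apply: (@le_trans _ _ ((r *+ 2)%:E * davg h x r)%E); last first.
    by apply: lee_wpmul2l; [rewrite lee_fin ltW|rewrite -(fineK fdr) lee_fin].
  rewrite -ID [leRHS]integral_mkcond /Rintegral fineK; last first.
    by apply: integrable_fin_num => //; apply: tame_integrable; tame_tac.
  apply: ge0_le_integral => //.
  - by move=> y _; rewrite lee_fin; apply: mulr_ge0; [exact: normr_ge0|exact: f0].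
  - have [[mDf _] _] : tame (fun y => D y * f y) by tame_tac.
    exact/measurable_EFinP.
  - apply/(measurable_restrictT _ _).1 => //; apply/measurable_EFinP/measurable_funTS.
    by case: bD.
  - move=> y _; rewrite patchE; case: ifPn => yB.
      by rewrite lee_fin ler_piMr ?normr_ge0// plateau_le1.
    rewrite lee_fin /f plateau_eq0 ?mulr0//.
    move: yB; rewrite notin_setE /ball/= => /negP; rewrite -leNgt ler_normr.
    by move=> /orP[yr|yr]; [left|right]; lra.
have IE : \int[mu]_y (h y * f y) <= \int[mu]_y (D y * f y + h x * f y).
  apply: le_integral_tame; [tame_tac..|] => y.
  by rewrite -mulrDl ler_wpM2r// -lerBlDr ler_norm.
rewrite integral_tameD in IE; [|tame_tac..].
rewrite integral_tameZ// in IE.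
have If := integral_plateau_ge x r0.
have := ler_wnM2l (ltW hx) If; rewrite -/f.
move: IE fD Hf; rewrite mulr2n; move: (Rintegral _ _ _) (Rintegral _ _ _) (h x * _) hx.
clear -r0; move=> X Y Z hx; move: r r0 => r r0.
have := mulr_gt0 r0 (_ : 0 < - h x); rewrite oppr_gt0 => /(_ hx).
by move: (h x) => c; lra.
Unshelve. all: by end_near. Qed.

End fundamental_lemma.

(** * Absorption *)

Section absorption_flow.
Context {R : realType}.
Implicit Types (f g : R -> R) (w W G : R * R -> R).
Local Notation mu := (leb R).
Local Notation mu2 := (leb2 R).

(** What the proof uses of a solution of u_t = -u^p with values in [0, 1], for
    a representative with these bounds everywhere. *)
Record absorption_flow (p : R) (W : R * R -> R) : Prop := {
  absorption_bounded : bounded_mfun W;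
  absorption_itv : forall z, 0 <= W z <= 1;
  absorption_continuous : continuous_L1loc W;
  absorption_weak : forall f g, smooth1 f -> smooth1 g ->
    bounded_support f -> positive_support g ->
    \int[mu]_t (slice_integral W f t * g^`()%classic t) =
    \int[mu]_t (slice_integral (fun z => W z `^ p) f t * g t) }.

Lemma le_integral_tame_ae (f g : R -> R) : tame f -> tame g ->
  (forall x, 0 <= f x) -> (forall x, 0 <= g x) ->
  {ae mu, forall x, f x <= g x} -> \int[mu]_x f x <= \int[mu]_x g x.
Proof.
move=> tf tg f0 g0 fg; rewrite -lee_fin /Rintegral !fineK; last 2 first.
  by apply: integrable_fin_num => //; exact: tame_integrable.
  by apply: integrable_fin_num => //; exact: tame_integrable.
apply: ae_ge0_le_integral => //.
- by move=> x _; rewrite lee_fin.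
- by apply/measurable_EFinP; case: tf => -[].
- by move=> x _; rewrite lee_fin.
- by apply/measurable_EFinP; case: tg => -[].
- by apply: filterS fg => x H _; rewrite lee_fin.
Qed.

Lemma ae_eq_integral_halfplane G1 G2 h : measurable_fun (halfplane R) G1 ->
  measurable_fun (halfplane R) G2 -> measurable_fun setT h ->
  {ae mu2, forall z, halfplane R z -> G1 z = G2 z} ->
  \int[mu2]_(z in halfplane R) (G1 z * h z) =
  \int[mu2]_(z in halfplane R) (G2 z * h z).
Proof.
move=> m1 m2 mh E; have mH := @measurable_halfplane R.
congr fine; apply: ae_eq_integral => //.
- by apply/measurable_EFinP; apply: measurable_funM => //; exact: measurable_funTS.
- by apply/measurable_EFinP; apply: measurable_funM => //; exact: measurable_funTS.
- by apply: filterS E => z Ez Hz; rewrite Ez.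
Qed.

Lemma truncation_absorption_flow p w : 1 < p -> measurable_fun (halfplane R) w ->
  continuous_L1loc w ->
  {ae mu2, forall z, halfplane R z -> 0 <= w z <= 1} ->
  absorption_distrib p w -> absorption_flow p (truncation 1 w).
Proof.
move=> p1 mw cw w01 dw; have bT := truncation_bounded ler01 mw.
split => //.
- by move=> z; exact: truncation_itv.
- exact: truncation_continuous_L1loc.
move=> f g sf sg bf pg; set W := truncation 1 w.
have bg := positive_support_bounded pg.
have [r fr] := bf; have [a [b [a0 gab]]] := pg.
have tst : test2 (tensor f g) by exact: test2_tensor a0 fr gab.
have W0 z : 0 <= W z by have /andP[] := truncation_itv w z ler01.
have bWp : bounded_mfun (fun z => W z `^ p).
  by apply: bounded_mfun_powR => //; exact: ltW (lt_trans ltr01 p1).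
have bNWp : bounded_mfun (fun z => -1 * W z `^ p) by exact: bounded_mfunZ.
have tf := smooth1_tame sf bf; have tg := smooth1_tame sg bg.
have tg' := derive1_tame sg bg.
have E : {ae mu2, forall z, halfplane R z -> w z = W z}.
  by apply: filterS w01 => z H Hz; rewrite /W truncation_id//; exact: H.
have mT f1 g1 : smooth1 f1 -> smooth1 g1 -> measurable_fun setT (tensor f1 g1).
  by move=> s1 s2; apply: measurable_tensor; exact: smooth1_measurable.
have := dw _ tst; rewrite dt_tensor//.
rewrite (@ae_eq_integral_halfplane w W)//; last 2 first.
- by apply: measurable_funTS; case: bT.
- by apply: mT; [exact: sf|exact: smooth1_derive].
rewrite (@ae_eq_integral_halfplane (fun z => - w z `^ p) (fun z => -1 * W z `^ p))//; last 4 first.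
- apply: measurableT_comp => //.
  exact: (measurableT_comp (measurable_powR p)).
- by apply: measurable_funTS; case: bNWp.
- exact: mT.
- by apply: filterS E => z Ez Hz; rewrite mulN1r Ez.
have [_ ->] := fubini_tensor bT tf tg'
  (fun t => positive_support_le0 (derive1_positive_support pg)).
have [_ ->] := fubini_tensor bNWp tf tg (fun t => positive_support_le0 pg).
have NE t : slice_integral (fun z => -1 * W z `^ p) f t =
    -1 * slice_integral (fun z => W z `^ p) f t.
  have bs : bounded_mfun (fun x => W (x, t) `^ p) by exact: (bounded_mfun_slice t bWp).
  rewrite /slice_integral -integral_tameZ; last by tame_tac.
  by apply: eq_Rintegral => x _; rewrite mulrA.
under [X in _ = X]eq_Rintegral do rewrite NE -mulrA.
rewrite integral_tameZ; last by tame_tac.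
by rewrite mulN1r => /oppr_inj.
Qed.

End absorption_flow.

Section absorption_estimates.
Context {R : realType}.
Variables (p : R) (W : R * R -> R).
Hypotheses (p1 : 1 < p) (HW : absorption_flow p W).
Implicit Types (f g : R -> R) (s t h k : R).
Local Notation mu := (leb R).

Let bW : bounded_mfun W := absorption_bounded HW.
Let W0 z : 0 <= W z. Proof. by have /andP[] := absorption_itv HW z. Qed.
Let W1 z : W z <= 1. Proof. by have /andP[] := absorption_itv HW z. Qed.
Let p0 : 0 <= p. Proof. exact: ltW (lt_trans ltr01 p1). Qed.
Let bWp : bounded_mfun (fun z => W z `^ p).
Proof. exact: bounded_mfun_powR. Qed.
Let bs t : bounded_mfun (fun x => W (x, t)).
Proof. exact: bounded_mfun_slice. Qed.
Let bsp t : bounded_mfun (fun x => W (x, t) `^ p).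
Proof. exact: (bounded_mfun_slice t bWp). Qed.

Let cW f s : tame f -> 0 < s -> {for s, continuous (slice_integral W f)}.
Proof.
by move=> tf s0; exact: (continuous_slice_integral bW tf (absorption_continuous HW)).
Qed.

Lemma absorption_slice_nincr f s t : smooth1 f -> bounded_support f ->
  (forall x, 0 <= f x) -> 0 < s -> s <= t ->
  slice_integral W f t <= slice_integral W f s.
Proof.
move=> sf bf f0 s0 st; have tf := smooth1_tame sf bf.
pose B x := -1 * slice_integral W f x.
have bB : bounded_mfun B by apply: bounded_mfunZ; exact: bounded_mfun_slice_integral.
have cB x : 0 < x -> {for x, continuous B}.
  by move=> x0; apply: cvgM; [exact: cvg_cst|exact: cW].
have weak s1 s2 h : 0 < s1 -> s1 < s2 -> 0 < h ->
    \int[mu]_x (B x * (plateau s1 s2 h)^`()%classic x) <=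
    0 * \int[mu]_x plateau s1 s2 h x.
  move=> s10 s12 h0; rewrite mul0r /B.
  have s12' := ltW s12.
  have sp := @plateau_smooth R s1 s2 h.
  have tp' : tame (plateau s1 s2 h)^`()%classic.
    by apply: derive1_tame => //; exact: plateau_bounded_support.
  under eq_Rintegral do rewrite -mulrA.
  rewrite integral_tameZ; last by tame_tac.
  rewrite (absorption_weak HW sf sp bf); last exact: plateau_positive_support.
  rewrite mulN1r oppr_le0; apply: Rintegral_ge0 => x _.
  rewrite mulr_ge0 ?plateau_ge0//; apply: Rintegral_ge0 => y _.
  by rewrite mulr_ge0 ?powR_ge0.
have := plateau_increment bB (lexx 0) cB weak s0 st.
by rewrite mul0r /B !mulN1r opprK addrC subr_le0.
Qed.

(** The solution decreases in the sense of distributions in time, for every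
    nonnegative test function in space. *)
Lemma absorption_nincr s t : 0 < s -> s <= t ->
  {ae mu, forall x, W (x, t) <= W (x, s)}.
Proof.
move=> s0 st.
have : {ae mu, forall x, 0 <= W (x, s) - W (x, t)}.
  apply: ae_ge0_of_tests; first exact: bounded_mfunB.
  move=> f sf bf f0; have tf := smooth1_tame sf bf.
  have := absorption_slice_nincr sf bf f0 s0 st; rewrite -subr_ge0 /slice_integral.
  rewrite -integral_tameB; [|tame_tac..].
  by under eq_Rintegral do rewrite -mulrBl.
by apply: filterS => x; rewrite subr_ge0.
Qed.

Lemma absorption_slice_powR_nincr f s t : smooth1 f -> bounded_support f ->
  (forall x, 0 <= f x) -> 0 < s -> s <= t ->
  slice_integral (fun z => W z `^ p) f t <= slice_integral (fun z => W z `^ p) f s.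
Proof.
move=> sf bf f0 s0 st; have tf := smooth1_tame sf bf; rewrite /slice_integral.
have ts : tame (fun x => W (x, s) `^ p * f x) by tame_tac.
have tt : tame (fun x => W (x, t) `^ p * f x) by tame_tac.
apply: le_integral_tame_ae; [exact: tt|exact: ts|..].
- by move=> x; rewrite mulr_ge0 ?powR_ge0.
- by move=> x; rewrite mulr_ge0 ?powR_ge0.
apply: filterS (absorption_nincr s0 st) => x H; apply: ler_wpM2r; first exact: f0.
by apply: ge0_ler_powR; rewrite ?nnegrE.
Qed.

(** After time s the rate of decrease is at most the one at time s, since u^p
    decreases as well. *)
Lemma absorption_euler s t : 0 < s -> s <= t ->
  {ae mu, forall x, W (x, s) - (t - s) * W (x, s) `^ p <= W (x, t)}.
Proof.
move=> s0 st.
have : {ae mu, forall x, 0 <= W (x, t) - W (x, s) + (t - s) * W (x, s) `^ p}.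
  apply: ae_ge0_of_tests; first by bounded_mfun_tac.
  move=> f sf bf f0; have tf := smooth1_tame sf bf.
  pose A := slice_integral W f; pose D := slice_integral (fun z => W z `^ p) f s.
  have bA : bounded_mfun A by exact: bounded_mfun_slice_integral.
  have D0 : 0 <= D by apply: Rintegral_ge0 => x _; rewrite mulr_ge0 ?powR_ge0.
  have weak s1 s2 h : s < s1 -> s1 < s2 -> 0 < h ->
      \int[mu]_x (A x * (plateau s1 s2 h)^`()%classic x) <=
      D * \int[mu]_x plateau s1 s2 h x.
    move=> ss1 s12 h0; have s12' := ltW s12; have s10 := lt_trans s0 ss1.
    have tp : tame (plateau s1 s2 h) by exact: plateau_tame.
    have sp := @plateau_smooth R s1 s2 h.
    rewrite (absorption_weak HW sf sp bf); last exact: plateau_positive_support.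
    rewrite -integral_tameZ; last exact: tp.
    apply: le_integral_tame; [tame_tac..|] => x.
    have [xs|/ltW sx] := leP x s; last first.
      by rewrite ler_wpM2r ?plateau_ge0//; exact: absorption_slice_powR_nincr.
    by rewrite plateau_eq0 ?mulr0//; left; exact: le_trans xs (ltW ss1).
  have cA s' : s < s' -> {for s', continuous A}.
    by move=> ss'; apply: cW => //; exact: lt_trans ss'.
  have inc s' : s < s' -> s' <= t -> A s' - A t <= D * (t - s').
    by move=> ss' s't; exact: (plateau_increment bA D0 cA weak).
  have inc0 : A s - A t <= D * (t - s).
    move: st; rewrite le_eqVlt => /predU1P[->|st]; first by rewrite !subrr mulr0.
    have cv : A s' - A t @[s' --> s^'+] --> A s - A t.
      apply: cvgB; last exact: cvg_cst.
      by apply: cvg_at_right_filter; exact: cW.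
    rewrite -(cvg_lim _ cv)//; apply: limr_le; first by apply/cvg_ex; eexists; exact: cv.
    near=> s'; have ss' : s < s' by near: s'; exact: nbhs_right_gt.
    apply: (le_trans (inc s' ss' _)); first by near: s'; exact: nbhs_right_le.
    by rewrite ler_wpM2l// lerD2l lerN2 ltW.
  have -> : \int[mu]_x ((W (x, t) - W (x, s) + (t - s) * W (x, s) `^ p) * f x) =
      A t - A s + (t - s) * D.
    rewrite /A /D /slice_integral -integral_tameB; [|tame_tac..].
    rewrite -integral_tameZ; last by tame_tac.
    rewrite -integral_tameD; [|tame_tac..].
    by apply: eq_Rintegral => x _; rewrite mulrDl mulrBl -mulrA.
  by rewrite -lerBlDl sub0r opprB mulrC.
apply: filterS => x H; rewrite lerBlDr -subr_ge0; apply: le_trans H _.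
by rewrite addrAC.
Unshelve. all: by end_near. Qed.

End absorption_estimates.

(** * The limit of the absorption problems *)

(** While y is above k, a step costs at most h and leaves y above k - h; below
    k, it costs at most h k^p. *)
Lemma euler_min_bound (R : realType) (p h k : R) (y : nat -> R) :
  0 <= p -> 0 <= h -> 0 <= k -> (forall j, 0 <= y j <= 1) ->
  (forall j, y j - h * y j `^ p <= y j.+1) ->
  forall j, Num.min (y 0%N) k - h - j%:R * (h * k `^ p) <= y j.
Proof.
move=> p0 h0 k0 y01 Hy; have hk : 0 <= h * k `^ p by rewrite mulr_ge0 ?powR_ge0.
elim=> [|j IH].
  rewrite mul0r subr0 lerBlDr; apply: (@le_trans _ _ (y 0%N)); last by rewrite lerDl.
  by rewrite ge_min lexx.
have /andP[yj0 yj1] := y01 j.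
have jhk : 0 <= j%:R * (h * k `^ p) by rewrite mulr_ge0.
apply: le_trans (Hy j); rewrite -natr1 mulrDl mul1r opprD addrA.
have [ky|yk] := leP k (y j).
  apply: (@le_trans _ _ (k - h)).
    have arith (a b c e f : R) : a <= e -> 0 <= b -> 0 <= c -> a - f - b - c <= e - f.
      by clear; lra.
    by apply: arith => //; rewrite ge_min lexx orbT.
  rewrite lerB// ler_piMr//; apply: (@le_trans _ _ (1 `^ p)); last by rewrite powR1.
  by apply: ge0_ler_powR; rewrite ?nnegrE ?ler01.
rewrite lerB// ler_wpM2l//.
by apply: ge0_ler_powR; rewrite ?nnegrE// ltW.
Qed.

Section weak_limit.
Context {R : realType}.
Local Notation mu := (leb R).
Local Notation mu2 := (leb2 R).

(** The Euler inequality is applied on N equal subintervals, simultaneously for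
    all N outside one null set; the error of one step vanishes as N grows. *)
Lemma absorption_lower p (W : R * R -> R) (s t k : R) : 1 < p ->
  absorption_flow p W -> 0 < s -> s <= t -> 0 <= k ->
  {ae mu, forall x, Num.min (W (x, s)) k - (t - s) * k `^ p <= W (x, t)}.
Proof.
move=> p1 HW s0 st k0; have ts0 : 0 <= t - s by rewrite subr_ge0.
have p0 : 0 <= p by exact: ltW (lt_trans ltr01 p1).
pose h (N : nat) := (t - s) / N.+1%:R.
have h0 N : 0 <= h N by rewrite divr_ge0.
have : {ae mu, forall x, forall N j : nat,
    W (x, s + j%:R * h N) - h N * W (x, s + j%:R * h N) `^ p <=
    W (x, s + j.+1%:R * h N)}.
  apply: ae_foralln => N; apply: ae_foralln => j.
  have e1 : s + j.+1%:R * h N - (s + j%:R * h N) = h N.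
    by rewrite -natr1 mulrDl mul1r; ring.
  have s1 : 0 < s + j%:R * h N by rewrite ltr_wpDr// mulr_ge0.
  have s12 : s + j%:R * h N <= s + j.+1%:R * h N.
    by rewrite lerD2l ler_wpM2r// ler_nat.
  by apply: filterS (absorption_euler p1 HW s1 s12) => x; rewrite e1.
apply: filterS => x Hx; apply/ler_addgt0Pl => e e0.
have [N hN] : exists N, h N <= e.
  near \oo => N; exists N; rewrite /h ler_pdivrMr// mulrC -ler_pdivrMr//.
  apply: (@le_trans _ _ N%:R); last by rewrite ler_nat.
  by near: N; exact: nbhs_infty_ger.
have := @euler_min_bound _ p (h N) k (fun j => W (x, s + j%:R * h N)) p0 (h0 N) k0
  (fun j => absorption_itv HW _) (Hx N) N.+1.
rewrite mul0r addr0 mulrA.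
have -> : N.+1%:R * h N = t - s by rewrite /h mulrC divfK// pnatr_eq0.
rewrite subrKC.
rewrite addrAC lerBlDl => H; apply: (le_trans H).
by rewrite lerD2r.
Unshelve. all: by end_near. Qed.

Lemma near_initial_arith (a b c d f g k v : R) : a <= b -> c - d <= a ->
  d <= f -> b - (1 - k) <= c -> - g <= v - b -> v - b <= g -> 0 <= f -> k <= 1 ->
  `|a - v| <= 1 - k + f + g.
Proof. by move=> *; rewrite ler_norml; apply/andP; split; lra. Qed.

(** The initial value is reached along the times t / (n + 1), countably many,
    so that the bounds hold for all of them off one null set. *)
Lemma absorption_near_initial p (W : R * R -> R) (v : R -> R) (t k : R) : 1 < p ->
  absorption_flow p W -> 0 < t -> 0 <= k <= 1 ->
  (forall x, 0 <= v x <= 1) ->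
  {ae mu, forall x, W (x, s) @[s --> 0^'+] --> v x} ->
  {ae mu, forall x, `|W (x, t) - v x| <= (1 - k) + t * k `^ p}.
Proof.
move=> p1 HW t0 /andP[k0 k1] v01 cv.
have sn0 (n : nat) : 0 < t / n.+1%:R by rewrite divr_gt0.
have snt (n : nat) : t / n.+1%:R <= t.
  by rewrite ler_pdivrMr// ler_peMr ?(ltW t0)// ler1n.
have H1 : {ae mu, forall x, forall n : nat, W (x, t) <= W (x, t / n.+1%:R)}.
  by apply: ae_foralln => n; exact: (absorption_nincr HW).
have H2 : {ae mu, forall x, forall n : nat,
    Num.min (W (x, t / n.+1%:R)) k - (t - t / n.+1%:R) * k `^ p <= W (x, t)}.
  by apply: ae_foralln => n; exact: (absorption_lower p1 HW).
move: cv H1 H2; apply: filterS3 => x cvx H1 H2.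
apply/ler_addgt0Pr => e e0.
have /cvgrPdist_le/(_ _ e0) near_e := cvx.
have [n Hn] : exists n : nat, `|v x - W (x, t / n.+1%:R)| <= e.
  have [d /= d0 Hd] : exists2 d : R, 0 < d & forall s, 0 < s -> s < d -> `|v x - W (x, s)| <= e.
    move: near_e => [d /= d0 Hd]; exists d => // s s0 sd.
    by apply: Hd => //=; rewrite sub0r normrN gtr0_norm.
  near \oo => n; exists n; apply: Hd => //.
  rewrite ltr_pdivrMr// mulrC -ltr_pdivrMr//.
  apply: (@lt_trans _ _ n%:R); last by rewrite ltr_nat.
  by near: n; exact: nbhs_infty_gtr.
have {}H1 := H1 n; have {}H2 := H2 n.
have /andP[v0 v1] := v01 x.
have kp := powR_ge0 k p.
have H3 : (t - t / n.+1%:R) * k `^ p <= t * k `^ p.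
  by rewrite ler_wpM2r// gerBl ltW.
have H4 : W (x, t / n.+1%:R) - (1 - k) <= Num.min (W (x, t / n.+1%:R)) k.
  have /andP[_ Wn1] := absorption_itv HW (x, t / n.+1%:R).
  by rewrite le_min gerBl subr_ge0 k1/= lerBlDr addrC subrK.
have tk : 0 <= t * k `^ p by rewrite mulr_ge0// ltW.
move: Hn; rewrite ler_norml => /andP[Hn1 Hn2].
exact: (near_initial_arith H1 H2 H3 H4 Hn1 Hn2 tk k1).
Unshelve. all: by end_near. Qed.

Lemma ae_fst (P : R -> Prop) : {ae mu, forall x, P x} ->
  {ae mu2, forall z, P z.1}.
Proof.
move=> [A [mA A0 PA]]; exists (A `*` setT); split.
- exact: measurableX.
- transitivity (lebesgue_measure A * lebesgue_measure [set: R])%E.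
    exact: product_measure1E.
  have -> : lebesgue_measure A = 0%E by exact: A0.
  by rewrite mul0e.
- by move=> z nP; split => //; exact: PA.
Qed.

Lemma integral_window_bound (G g : R * R -> R) (r C : R) : bounded_mfun G ->
  measurable_fun setT g ->
  (forall z, `|g z| <= C * tensor (box r) (time_box r) z) ->
  mu2.-integrable (halfplane R) (EFin \o (fun z => G z * g z)) /\
  `|\int[mu2]_(z in halfplane R) (G z * g z)| <=
    C * \int[mu]_t (slice_integral (fun z => `|G z|) (box r) t * time_box r t).
Proof.
move=> bG mg gC; have mH := @measurable_halfplane R.
have tb := box_tame r; have tt := time_box_tame r.
have t0 t : t <= 0 -> time_box r t = 0 by move=> tle; rewrite time_boxE ltNge tle.
have bN : bounded_mfun (fun z => `|G z|) by exact: bounded_mfun_norm.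
have [iG <-] := fubini_tensor bN tb tt t0.
have iC : mu2.-integrable (halfplane R)
    (EFin \o (fun z => C * (`|G z| * tensor (box r) (time_box r) z))).
  have [iCG _] := fubini_tensor (bounded_mfunZ C bN) tb tt t0.
  rewrite (_ : (fun z => _) = fun z => C * `|G z| * tensor (box r) (time_box r) z)//.
  by apply/funext => z; rewrite mulrA.
have le z : `|G z * g z| <= C * (`|G z| * tensor (box r) (time_box r) z).
  by rewrite normrM mulrCA ler_wpM2l.
have i1 : mu2.-integrable (halfplane R) (EFin \o (fun z => G z * g z)).
  apply: le_integrable iC => //.
    apply/measurable_EFinP; apply: measurable_funTS; apply: measurable_funM => //.
    by case: bG.
  move=> z _; rewrite lee_fin; apply: (le_trans (le z)); exact: ler_norm.
split => //; rewrite -RintegralZl//.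
apply: le_trans; first exact: le_normr_Rintegral.
apply: le_Rintegral => //.
by have := integrable_abse i1; apply: eq_integrable.
Qed.

(** Off null sets the distance to the initial value is at most
    (1 - k) + r k^p up to time r, for every k. *)
Lemma weak_limit (v : R -> R) (U : R -> R * R -> R) :
  measurable_fun setT v -> {ae mu, forall x, 0 <= v x <= 1} ->
  (forall p, 1 < p -> measurable_fun (halfplane R) (U p) /\ continuous_L1loc (U p)) ->
  (forall p, 1 < p -> {ae mu2, forall z, halfplane R z -> 0 <= U p z <= 1}) ->
  (forall p, 1 < p -> absorption_distrib p (U p)) ->
  (forall p, 1 < p -> {ae mu, forall x, U p (x, t) @[t --> 0^'+] --> v x}) ->
  weak_cvg_L1loc_halfplane U (fun z => v z.1).
Proof.
move=> mv v01 mU U01 dU cU g mg [Mg gM] [K [cK KH gK]].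
have [r r0 Kr] := compact_sub_window cK KH.
pose C := `|Mg|; have C0 : 0 <= C by exact: normr_ge0.
have gC z : `|g z| <= C * tensor (box r) (time_box r) z.
  have := congr1 (@^~ z) (patch_window (fun=> C) r); rewrite /= patchE => <-.
  case: ifPn => [_|/negP zw]; first exact: le_trans (gM z) (ler_norm _).
  by rewrite gK ?normr0// => Kz; apply: zw; rewrite inE; exact: Kr.
pose v' x := Num.min (Num.max (v x) 0) 1.
have v'01 x : 0 <= v' x <= 1.
  by rewrite le_min le_max lexx orbT ler01 ge_min lexx orbT.
have v'E : {ae mu, forall x, v x = v' x}.
  by apply: filterS v01 => x /andP[v0 v1]; rewrite /v' max_l// min_l.
have bv : bounded_mfun v'.
  split; first by apply: measurable_minr => //; exact: measurable_maxr.
  by exists 1 => x; have /andP[H0 H1] := v'01 x; rewrite ger0_norm.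
have bV : bounded_mfun (fun z : R * R => v' z.1).
  case: (bv) => mv' [D hD]; split; last by exists D => z.
  exact: (measurableT_comp mv' measurable_fst).
have tb := box_tame r.
pose S := \int[mu]_x box r x.
have S0 : 0 <= S by apply: Rintegral_ge0 => x _; exact: box_ge0.
pose Q := C * (S * r).
have Q0 : 0 <= Q by rewrite !mulr_ge0// ltW.
have main p k : 1 < p -> 0 <= k <= 1 ->
    `|\int[mu2]_(z in halfplane R) (v z.1 * g z) -
      \int[mu2]_(z in halfplane R) (U p z * g z)| <= Q * ((1 - k) + r * k `^ p).
  move=> p1 k01; have [mUp cUp] := mU _ p1.
  have HW := truncation_absorption_flow p1 mUp cUp (U01 _ p1) (dU _ p1).
  set W := truncation 1 (U p) in HW; have bW := absorption_bounded HW.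
  have /andP[k0 k1] := k01.
  set d := (1 - k) + r * k `^ p.
  have d0 : 0 <= d by rewrite addr_ge0 ?subr_ge0// mulr_ge0 ?powR_ge0// ltW.
  have cW : {ae mu, forall x, W (x, s) @[s --> 0^'+] --> v' x}.
    move: v01 (cU _ p1); apply: filterS2 => x /andP[v0 v1] cx.
    apply/cvgrPdist_le => e e0; have /cvgrPdist_le/(_ _ e0) near_e := cx.
    near=> s; have s0 : 0 < s by near: s; exact: nbhs_right_gt.
    rewrite /W /truncation/= s0 /v'; apply: le_trans (min_max_lipschitz _ _ _) _.
    by near: s; exact: near_e.
  rewrite (@ae_eq_integral_halfplane _ (U p) W)//; last 2 first.
  - by apply: measurable_funTS; case: bW.
  - by apply: filterS (U01 _ p1) => z H Hz; rewrite /W truncation_id//; exact: H.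
  rewrite (@ae_eq_integral_halfplane _ (fun z => v z.1) (fun z => v' z.1))//; last 3 first.
  - by apply: measurable_funTS; exact: (measurableT_comp mv measurable_fst).
  - by apply: measurable_funTS; case: bV.
  - by have := ae_fst v'E; apply: filterS => z E _.
  have [iV _] := integral_window_bound bV mg gC.
  have [iW _] := integral_window_bound bW mg gC.
  have bD : bounded_mfun (fun z => v' z.1 - W z) by exact: bounded_mfunB.
  have [_ H] := integral_window_bound bD mg gC.
  rewrite -RintegralB//; last exact: measurable_halfplane.
  under eq_Rintegral do rewrite -mulrBl.
  apply: (le_trans H); rewrite /Q -mulrA ler_wpM2l//.
  apply: (@le_trans _ _ (S * d * r)); last by rewrite mulrAC.
  have bN : bounded_mfun (fun z => `|v' z.1 - W z|) by exact: bounded_mfun_norm.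
  apply: integral_window_le => // t /andP[t0 tr].
  rewrite mulrC -integral_tameZ//; apply: le_integral_tame_ae.
  - by apply: tameMl => //; exact: (bounded_mfun_slice t bN).
  - exact: tameZ.
  - by move=> x; rewrite mulr_ge0 ?box_ge0.
  - by move=> x; rewrite mulr_ge0 ?box_ge0.
  have := absorption_near_initial p1 HW t0 k01 v'01 cW.
  apply: filterS => x Hx; rewrite ler_wpM2r ?box_ge0//= distrC.
  apply: (le_trans Hx); rewrite lerD2l ler_wpM2r ?powR_ge0//.
apply/cvgrPdist_le => e e0.
have e2 : 0 < e / 2 by rewrite divr_gt0.
have Q1 : 0 < Q + 1 by rewrite ltr_wpDl.
pose k := 1 - Num.min (e / 2 / (Q + 1)) 1.
have m0 : 0 < Num.min (e / 2 / (Q + 1)) 1 by rewrite lt_min ltr01 andbT divr_gt0.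
have k01 : 0 <= k < 1 by rewrite subr_ge0 ge_min lexx orbT gtrBl.
have k01' : 0 <= k <= 1 by have /andP[-> /ltW ->] := k01.
have er : 0 < e / 2 / (Q + 1) / r by rewrite !divr_gt0.
have /cvgrPdist_le/(_ _ er) kp := powR_lt1_cvg0 k01.
near=> p; have p1 : 1 < p by near: p; apply: nbhs_pinfty_gt; exact: num_real.
apply: (le_trans (main _ _ p1 k01')).
have kpe : k `^ p <= e / 2 / (Q + 1) / r.
  apply: le_trans (ler_norm _) _; rewrite -normrN -sub0r; near: p; exact: kp.
have half a : 0 <= a -> a <= e / 2 / (Q + 1) -> Q * a <= e / 2.
  move=> a0 ae; apply: (@le_trans _ _ ((Q + 1) * a)); first by rewrite ler_wpM2r// lerDl.
  by rewrite mulrC -ler_pdivlMr.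
rewrite mulrDr [leRHS]splitr lerD//; apply: half.
- by rewrite /k opprD addNKr opprK ltW.
- by rewrite /k opprD addNKr opprK ge_min lexx.
- by rewrite mulr_ge0 ?powR_ge0// ltW.
- by rewrite mulrC -ler_pdivlMr.
Unshelve. all: by end_near. Qed.

End weak_limit.

Unset Implicit Arguments.

(** * The theorem *)

Theorem theorem1p3 (R : realType) (u0 : R -> R)
    (u : R -> R -> R * R -> R)      (* u m p = u_{m,p} *)
    (u_inf_p : R -> R * R -> R)     (* u_inf_p p = u_{oo,p} *)
    (u_inf0 : R -> R)               (* u_oo^0 *)
    (u_m_inf : R -> R * R -> R)     (* u_m_inf m = u_{m,oo} *)
  (u0_ge0 : {ae leb R, forall x, 0 <= u0 x})
  (u0_L1_Linfty : in_L1_Linfty u0)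
  (u_sol : forall m p : R, 1 < m -> 1 < p ->
    kruzkov_solution m (fun s => - (s `^ p)) u0 (u m p) /\
    continuous_L1loc (u m p))
  (* u_{oo,p}, p > 1, and its initial value *)
  (u_inf_p_lim : forall p : R, 1 < p ->
    cvg_C_L1loc (fun m => u m p) (u_inf_p p))
  (u_inf_p_01 : forall p : R, 1 < p ->
    {ae leb2 R, forall z, halfplane R z -> 0 <= u_inf_p p z <= 1})
  (u_inf_p_eq : forall p : R, 1 < p -> absorption_distrib p (u_inf_p p))
  (u_inf0_init : forall p : R, 1 < p ->
    {ae leb R, forall x, u_inf_p p (x, t) @[t --> 0^'+] --> u_inf0 x})
  (u_inf0_char : stationary_limit u_inf0 u0)
  (* u_{m,oo}, m > 1 *)
  (u_m_inf_lim : forall m : R, 1 < m ->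
    cvg_C_L1loc (fun p => u m p) (u_m_inf m))
  (u_m_inf_sol : forall m : R, 1 < m ->
    kruzkov_solution m (fun=> 0) (fun x => Num.min (u0 x) 1) (u_m_inf m)) :
  (exists v1 : R -> R,
     cvg_L1loc_halfplane u_m_inf (fun z => v1 z.1) /\
     stationary_limit v1 (fun x => Num.min (u0 x) 1)) /\
  weak_cvg_L1loc_halfplane u_inf_p (fun z => u_inf0 z.1).
Proof.
split.
  exists (clip u0); split; last exact: stationary_limit_clip.
  apply: strong_limit => // m m1.
  by have [_ cm _] := u_m_inf_lim m m1.
have [mv v01 _] := u_inf0_char.
apply: weak_limit => // p p1.
by have [mp cp _] := u_inf_p_lim p p1.
Qed.
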